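(* Let $n\ge 0$ be an integer and let $(M,d)$ be a complete metric space. Then the following are equivalent: (i) $M$ is $LC^n$; (ii) $M$ is $ALC^n$; (iii) $M$ is $WLC^n$.
   Context: All maps are continuous. $\mathbb S^k$ is the $k$-sphere, and $k$ ranges over integers $0\le k\le n$. A space $M$ is $LC^n$ (locally $n$-connected) if for every $x\in M$ and every open neighborhood $U$ of $x$ in $M$ there is a neighborhood $V$ of $x$ in $M$ such that every map $\mathbb S^k\to V$, $k\le n$, is null-homotopic in $U$. If $M\subset Y$ is closed and $U\subset M$ is open in $M$, an open extension of $U$ in $Y$ is an open set $\widetilde U\subset Y$ with $\widetilde U\cap M=U$. $M$ is weakly locally $n$-connected ($WLC^n$) in $Y$ if $M\subset Y$ is closed and for every $x\in M$ and every open neighborhood $U$ of $x$ in $M$ there is a neighborhood $V$ of $x$ in $M$ such that for every open extension $\widetilde U$ of $U$ in $Y$, every map $\mathbb S^k\to V$, $k\le n$, is null-homotopic in $\widetilde U$. $M$ is approximately locally $n$-connected ($ALC^n$) in $Y$ if $M\subset Y$ is closed and for every $x\in M$ and every open neighborhood $U$ of $x$ in $M$ there is a neighborhood $V$ of $x$ in $M$ such that for every open extension $\widetilde U$ of $U$ in $Y$ there is an open extension $\widetilde V$ of $V$ in $Y$ such that every map $\mathbb S^k\to\widetilde V$, $k\le n$, is null-homotopic in $\widetilde U$. A metrizable space $M$ is called $WLC^n$ (resp., $ALC^n$) if it is $WLC^n$ (resp., $ALC^n$) in some metrizable $ANR$ (absolute neighborhood retract) containing $M$ as a closed subset; this is equivalent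 to being $WLC^n$ (resp., $ALC^n$) in every metrizable $ANR$ containing $M$ as a closed subset. *)

(* Defs.v *)
From HB Require Import structures.
From mathcomp Require Import all_boot all_order all_algebra.
From mathcomp Require Import all_classical all_reals all_analysis.

Set Implicit Arguments.
Unset Strict Implicit.
Unset Printing Implicit Defensive.

Import Order.TTheory GRing.Theory Num.Theory.
Import numFieldNormedType.Exports.

Local Open Scope classical_set_scope.
Local Open Scope ring_scope.

(* The Euclidean unit sphere; the library norm on 'rV[R]_k.+1 is the sup norm,
   hence the explicit sum of squares. *)
Definition sphere (R : realType) (k : nat) : set 'rV[R]_k.+1 :=
  [set x | \sum_(i < k.+1) x ord0 i ^+ 2 = 1].
Arguments sphere : clear implicits.

(* Only the values of [f] on the sphere are meaningful: a map S^k -> V is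
   represented by an arbitrary extension of it to the ambient space, and
   continuity is required for the subspace topology of the sphere. *)
Definition sphere_map (R : realType) (k : nat) (Y : topologicalType)
    (V : set Y) (f : 'rV[R]_k.+1 -> Y) : Prop :=
  {within sphere R k, continuous f} /\ f @` sphere R k `<=` V.

Definition null_homotopic_in (R : realType) (k : nat) (Y : topologicalType)
    (U : set Y) (f : 'rV[R]_k.+1 -> Y) : Prop :=
  exists (H : R * 'rV[R]_k.+1 -> Y) (c : Y),
    [/\ {within `[0, 1] `*` sphere R k, continuous H},
        H @` (`[0, 1] `*` sphere R k) `<=` U,
        forall x, sphere R k x -> H (0, x) = f x
      & forall x, sphere R k x -> H (1, x) = c].

Definition LC (R : realType) (n : nat) (M : topologicalType) : Prop :=
  forall (x : M) (U : set M), open U -> U x ->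
  exists2 V : set M, nbhs x V &
    forall k : nat, (k <= n)%N -> forall f : 'rV[R]_k.+1 -> M,
      sphere_map V f -> null_homotopic_in U f.

Definition open_in (Y : topologicalType) (A U : set Y) : Prop :=
  exists2 O : set Y, open O & O `&` A = U.

Definition nbhs_in (Y : topologicalType) (A : set Y) (x : Y) (V : set Y) :
    Prop :=
  V `<=` A /\ exists2 W : set Y, open_in A W & W x /\ W `<=` V.

Definition open_extension (Y : topologicalType) (A U Ue : set Y) : Prop :=
  open Ue /\ Ue `&` A = U.

Definition WLC_in (R : realType) (n : nat) (Y : topologicalType) (A : set Y) :
    Prop :=
  closed A /\
  forall (x : Y) (U : set Y), A x -> open_in A U -> U x ->
  exists2 V : set Y, nbhs_in A x V &
    forall Ue : set Y, open_extension A U Ue ->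
    forall k : nat, (k <= n)%N -> forall f : 'rV[R]_k.+1 -> Y,
      sphere_map V f -> null_homotopic_in Ue f.

(* Having an open extension forces [V] to be open in [A]. *)
Definition ALC_in (R : realType) (n : nat) (Y : topologicalType) (A : set Y) :
    Prop :=
  closed A /\
  forall (x : Y) (U : set Y), A x -> open_in A U -> U x ->
  exists2 V : set Y, nbhs_in A x V &
    forall Ue : set Y, open_extension A U Ue ->
    exists2 Ve : set Y, open_extension A V Ve &
    forall k : nat, (k <= n)%N -> forall f : 'rV[R]_k.+1 -> Y,
      sphere_map Ve f -> null_homotopic_in Ue f.

Definition closed_embedding (X Y : topologicalType) (e : X -> Y) : Prop :=
  [/\ continuous e, injective e, closed (range e)
    & forall U : set X, open U -> open_in (range e) (e @` U)].

Definition neighborhood_retract (Z : topologicalType) (A : set Z) : Prop :=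
  exists (W : set Z) (r : Z -> Z),
    [/\ open W, A `<=` W, {within W, continuous r},
        r @` W `<=` A & forall a, A a -> r a = a].

(* Absolute neighborhood retract for metrizable spaces. A metrizable space is
   presented as a [metricType]; only its topology is used. *)
Definition ANR (R : realType) (X : metricType R) : Prop :=
  forall (Z : metricType R) (e : X -> Z),
    closed_embedding e -> neighborhood_retract (range e).

Definition WLC (R : realType) (n : nat) (M : metricType R) : Prop :=
  exists (Y : metricType R) (e : M -> Y),
    [/\ ANR Y, closed_embedding e & WLC_in R n (range e)].

Definition ALC (R : realType) (n : nat) (M : metricType R) : Prop :=
  exists (Y : metricType R) (e : M -> Y),
    [/\ ANR Y, closed_embedding e & ALC_in R n (range e)].

(* The library's [completeType] also requires a point; here [M] may be empty. *)
Definition complete_metric (R : realType) (M : metricType R) : Prop :=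
  forall F : set_system M, ProperFilter F -> cauchy F -> exists l : M, F --> l.

(* Main.v *)
Require Import Defs.
From HB Require Import structures.
From mathcomp Require Import all_boot all_order all_algebra.
From mathcomp Require Import all_classical all_reals all_analysis.
From mathcomp Require Import ring lra zify.

Set Implicit Arguments.
Unset Strict Implicit.
Unset Printing Implicit Defensive.

Import Order.TTheory GRing.Theory Num.Theory.
Import numFieldNormedType.Exports.

Local Open Scope classical_set_scope.
Local Open Scope ring_scope.

(** Why the three conditions agree.

    ALC implies WLC because a sphere lying in [V] lies in every open extension
    of [V].  The two other implications compare maps into [Y] that stay close
    to [M] with maps into [M].  Spheres and null homotopies are replaced
    throughout by boundaries of cubes and extensions to the cubes
    ([fillable_null_homotopic], [null_homotopic_fillable]), because cubes
    subdivide into grids of cubes.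

    The tool common to both directions is [skeleton_extension].  Suppose that
    small boundaries of cubes of dimension at most [n] can be filled in [M]
    with small image.  Then an assignment of points of [M] to the vertices of
    a fine grid extends, cell by cell, to the [n]-skeleton of the grid, with
    small images of all cells.  How small is small depends on the place in
    [M]; this is measured by positive 1-Lipschitz functions ([gauge]).

    From LC to ALC.  The space [Y] of functions from [M] to the unit interval,
    with the supremum distance, contains [M] isometrically as far as small
    distances are concerned, by sending [x] to its truncated distance
    function, and the image is closed since [M] is complete.  It is an ANR:
    an explicit formula of Hausdorff extends a real function from a closed set
    with a modulus of continuity that can be read off from the function, so it
    may be applied to all coordinates at once ([unit_fun_extension]).  A
    sphere in [Y] near [M] is close to a map of the skeleton of a fine grid on
    its domain into [M], and segments of the convex space [Y] join the two
    maps inside the prescribed open extension.  The map into [M] contracts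
    by LC.

    From WLC to LC.  By induction on [n] it may be assumed that cubes of
    dimension at most [n] can be filled in [M], so that only boundaries of
    cubes of dimension [n.+1] are left.  Weak local connectedness fills such
    a boundary in [Y], as close to [M] as desired.  Moving the vertices of a
    fine grid into [M] and extending to its [n]-skeleton yields a map into [M]
    defined on the boundaries of all subcubes, each of which has a much
    smaller image ([refine_boundary]).  Every subcube is then treated in the
    same way, independently of the others, since the map on its boundary is
    never changed again.  The resulting approximations converge uniformly and
    their oscillation tends to zero, so completeness of [M] provides a
    continuous filling in [M] ([approx_limit]). *)

(** * Continuity on subsets and oscillation *)

Section Oscillation.
Context {R : realType}.

(** The bound [e] is fixed so that one pasting lemma serves both continuous maps
    and the discontinuous approximations of a continuous limit. *)
Definition osc_le (X : topologicalType) (Y : metricType R) (A : set X)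
    (f : X -> Y) (x : X) (e : R) : Prop :=
  \forall y \near x, A y -> mdist (f x) (f y) <= e.

Lemma within_oscP (X : topologicalType) (Y : metricType R) (A : set X)
    (f : X -> Y) :
  {within A, continuous f} <->
  forall x, A x -> forall e, 0 < e -> osc_le A f x e.
Proof.
rewrite subspace_continuousP; split=> H x Ax.
  by move=> e e0; have /metricType_numDomainType.cvgrPdist_le/(_ e e0) := H x Ax.
by apply/metricType_numDomainType.cvgrPdist_le => e e0; exact: H.
Qed.

(** The pieces that miss [x] are closed, hence miss a neighborhood of [x]. *)
Lemma osc_le_paste (X : topologicalType) (Y : metricType R) (I : finType)
    (F : I -> set X) (A : set X) (f : X -> Y) x e :
  (forall i, closed (F i)) -> (forall y, A y -> exists i, F i y) ->
  (forall i, F i x -> osc_le (A `&` F i) f x e) -> osc_le A f x e.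
Proof.
move=> clF AF H.
have : \forall y \near x, forall i, F i y -> F i x /\
    (F i x -> A y -> mdist (f x) (f y) <= e).
  apply: filter_forall => i; have [Fx|nFx] := pselect (F i x).
    by apply: filterS (H i Fx) => y Hy Fy; split => // _ Ay; apply: Hy.
  have : \forall y \near x, (~` F i) y.
    by apply: open_nbhs_nbhs; split => //; exact: closed_openC.
  by apply: filterS => y.
apply: filterS => y Hy Ay; have [i Fy] := AF _ Ay.
by have [Fx] := Hy i Fy; apply.
Qed.

Lemma within_paste (X : topologicalType) (Y : metricType R) (I : finType)
    (F : I -> set X) (A : set X) (f : X -> Y) :
  (forall i, closed (F i)) -> (forall y, A y -> exists i, F i y) ->
  (forall i, {within A `&` F i, continuous f}) -> {within A, continuous f}.
Proof.
move=> clF AF H; apply/within_oscP => x Ax e e0.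
apply: (osc_le_paste clF AF) => i Fx.
by have /within_oscP/(_ x (conj Ax Fx) e e0) := H i.
Qed.

Lemma within_paste2 (X : topologicalType) (Y : metricType R)
    (F G : set X) (A : set X) (f : X -> Y) :
  closed F -> closed G -> (forall y, A y -> F y \/ G y) ->
  {within A `&` F, continuous f} -> {within A `&` G, continuous f} ->
  {within A, continuous f}.
Proof.
move=> cF cG AFG fF fG.
apply: (@within_paste _ _ bool (fun b => if b then F else G)) => [[]//|y /AFG|[]//].
by case; [exists true|exists false].
Qed.

End Oscillation.

Lemma within_eq (X Y : topologicalType) (A : set X) (f g : X -> Y) :
  (forall x, A x -> f x = g x) ->
  {within A, continuous f} -> {within A, continuous g}.
Proof.
by move=> fg; apply: subspace_eq_continuous => x /set_mem; exact: fg.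
Qed.

Lemma within_comp (X Y Z : topologicalType) (A : set X) (B : set Y)
    (f : X -> Y) (g : Y -> Z) :
  (forall x, A x -> B (f x)) -> {within A, continuous f} ->
  {within B, continuous g} -> {within A, continuous (fun x => g (f x))}.
Proof.
rewrite !subspace_continuousP => AB fc gc x Ax W /(gc _ (AB _ Ax)) /=.
rewrite /within/= => /(fc _ Ax).
by rewrite /nbhs/= /within/=; apply: filterS => y Hy Ay; exact: (Hy Ay (AB _ Ay)).
Qed.

Lemma within_continuous (X Y : topologicalType) (A : set X) (f : X -> Y) :
  continuous f -> {within A, continuous f}.
Proof. exact: continuous_subspaceT. Qed.

Lemma within_cst (X Y : topologicalType) (A : set X) (y : Y) :
  {within A, continuous (fun _ : X => y)}.
Proof. by apply: continuous_subspaceT => x; exact: cvg_cst. Qed.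

(** * Lipschitz gauges *)

Section Gauges.
Context {R : realType}.

(** A positive 1-Lipschitz function on [M], prescribing at each point how small
    is small there.  The Lipschitz bound makes the values at two points that
    are close on this scale comparable, which replaces passing to star
    refinements of open covers. *)
Definition gauge (M : metricType R) (a : M -> R) : Prop :=
  (forall x, 0 < a x) /\ forall x y, a x <= a y + mdist x y.

Definition small (T : Type) (M : metricType R) (a : M -> R) (h : T -> M)
    (S : set T) : Prop :=
  forall p q, S p -> S q -> mdist (h p) (h q) < a (h p).

Definition mball (M : metricType R) (x : M) (r : R) : set M :=
  [set y | mdist x y < r].

Lemma mballE (M : metricType R) (x : M) r : mball x r = ball x r.
Proof. by rewrite ballEmdist. Qed.

Lemma open_mball (M : metricType R) (x : M) r : open (mball x r).
Proof.
rewrite openE => y xy; apply/nbhs_ballP; exists (r - mdist x y).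
  by rewrite /= subr_gt0.
rewrite -mballE => z yz; rewrite /mball/= in yz *.
by have := metric_triangle x y z; lra.
Qed.

Lemma nbhs_mballP (M : metricType R) (x : M) (V : set M) :
  nbhs x V <-> exists2 r, 0 < r & mball x r `<=` V.
Proof.
split=> [/nbhs_ballP[r r0 H]|[r r0 H]].
  by exists r => //; rewrite mballE.
by apply/nbhs_ballP; exists r => //; rewrite -mballE.
Qed.

(** Call [r] admissible at [x] if [P y r] holds at all points [y] of the ball of
    radius [r] at [x].  Moving [x] by a distance [t] turns an admissible [r] into
    an admissible [r - t], so the supremum of the admissible radii is
    1-Lipschitz; half of it is admissible. *)
Lemma gauge_inf (M : metricType R) (P : M -> R -> Prop) :
  (forall x r s, s <= r -> P x r -> P x s) ->
  (forall x, exists2 r, 0 < r & forall y, mdist x y < r -> P y r) ->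
  exists2 a : M -> R, gauge a & forall x, P x (a x).
Proof.
move=> Pmon Ploc.
pose S x := [set r | [/\ 0 < r, r <= 1 & forall y, mdist x y < r -> P y r]].
have S0 x : S x !=set0.
  have [r r0 Pr] := Ploc x; exists (Num.min r 1); split.
  - by rewrite lt_min r0 ltr01.
  - by rewrite ge_min lexx orbT.
  - move=> y; rewrite lt_min => /andP[+ _] => /Pr; apply: Pmon.
    by rewrite ge_min lexx.
have Sub x : has_ubound (S x) by exists 1 => r [].
have Ssup x : has_sup (S x) by split.
have sup_gt0 x : 0 < sup (S x).
  by have [r Sr] := S0 x; case: (Sr) => r0 _ _; apply: lt_le_trans r0 _; exact: ub_le_sup.
exists (fun x => sup (S x) / 2).
  split=> [x|x y]; first by rewrite divr_gt0.
  suff : sup (S x) <= sup (S y) + mdist x y.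
    by have := mdist_ge0 x y; lra.
  apply: ge_sup => // r [r0 r1 Pr].
  have [rd|dr] := leP r (mdist x y).
    by have := sup_gt0 y; lra.
  rewrite -lerBlDr; apply: ub_le_sup => //; split.
  - by rewrite subr_gt0.
  - by have := mdist_ge0 x y; lra.
  move=> z yz; apply: (@Pmon z r); first by have := mdist_ge0 x y; lra.
  by apply: Pr; have := metric_triangle x y z; lra.
move=> x.
have h : sup (S x) / 2 < sup (S x) by rewrite ltr_pdivrMr// ltr_pMr// ltr1n.
have [r Sr hr] := sup_gt (S0 x) h.
case: Sr => r0 _ /(_ x); rewrite mdistxx => /(_ r0).
by apply: Pmon; exact: ltW.
Qed.

End Gauges.

(** * Cubes and spheres *)

Section Cubes.
Context {R : realType}.

Lemma rv_norm_leP d (x : 'rV[R]_d) r :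
  0 <= r -> reflect (forall i, `|x ord0 i| <= r) (`|x| <= r).
Proof.
move=> r0; rewrite /Num.norm/= mx_normrE; apply: (iffP (bigmax_leP _ _ _ _)).
  by move=> [_ H] i; exact: (H (ord0, i)).
by move=> H; split; [exact: r0|move=> [i j] _; rewrite /= ord1; exact: H].
Qed.

Lemma rv_coord_le d (x : 'rV[R]_d) i : `|x ord0 i| <= `|x|.
Proof. by move: i; apply/rv_norm_leP. Qed.

Lemma rv_norm_attained d (x : 'rV[R]_d) : 0 < `|x| -> exists i, `|x ord0 i| = `|x|.
Proof.
move=> x0; have /mx_norm_neq0[[i j]] : mx_norm x != 0.
  by rewrite -[mx_norm x]/`|x| gt_eqF.
by rewrite -[mx_norm x]/`|x| /= ord1 => ->; exists j.
Qed.

Definition cube d : set 'rV[R]_d := [set x | `|x| <= 1].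
Definition cube_bd d : set 'rV[R]_d := [set x | `|x| = 1].
Arguments cube : clear implicits.
Arguments cube_bd : clear implicits.

Lemma cube_bd_sub d : cube_bd d `<=` cube d.
Proof. by move=> x; rewrite /cube_bd/cube/= => ->. Qed.

Lemma cube_bd_const1 k : cube_bd k.+1 (const_mx 1).
Proof.
apply/eqP; rewrite eq_le; apply/andP; split.
  by apply/(rv_norm_leP _ ler01) => i; rewrite mxE normr1.
by have := rv_coord_le (const_mx 1 : 'rV[R]_k.+1) ord0; rewrite mxE normr1.
Qed.

Lemma closed_cube d : closed (cube d).
Proof.
apply: (@closed_comp _ _ (fun x : 'rV[R]_d => `|x| : R) [set r | r <= 1]).
  by move=> x _; exact: norm_continuous.
exact: closed_le.
Qed.

Lemma closed_cube_bd d : closed (cube_bd d).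
Proof.
apply: (@closed_comp _ _ (fun x : 'rV[R]_d => `|x| : R) [set r | r = 1]).
  by move=> x _; exact: norm_continuous.
exact: closed_eq.
Qed.

Lemma compact_cube d : compact (cube d).
Proof.
apply: bounded_closed_compact (@closed_cube d).
exists 1; split; first exact: num_real.
by move=> r r1 x; rewrite /cube/= => x1; rewrite (le_trans x1)// ltW.
Qed.

Lemma compact_cube_bd d : compact (cube_bd d).
Proof.
exact: (subclosed_compact (@closed_cube_bd d) (@compact_cube d) (@cube_bd_sub d)).
Qed.

Definition norm2 d (x : 'rV[R]_d) : R := Num.sqrt (\sum_i x ord0 i ^+ 2).

Lemma norm2_continuous d : continuous (@norm2 d).
Proof.
move=> x; apply: (@continuous_comp _ _ _ (fun x : 'rV[R]_d => \sum_i x ord0 i ^+ 2)).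
  apply: (@cvg_big _ _ +%R 0 xpredT _ _ (nbhs x)) => [p|i _].
    exact: add_continuous.
  rewrite expr2; under eq_cvg do rewrite expr2.
  by apply: cvgM; exact: coord_continuous.
exact: sqrt_continuous.
Qed.

Lemma sqr_sum_ge0 d (x : 'rV[R]_d) : 0 <= \sum_i x ord0 i ^+ 2.
Proof. by apply: sumr_ge0 => i _; exact: sqr_ge0. Qed.

Lemma norm2_gt0 d (x : 'rV[R]_d) : x != 0 -> 0 < norm2 x.
Proof.
move=> x0; rewrite sqrtr_gt0 lt_neqAle sqr_sum_ge0 andbT eq_sym.
apply: contraNN x0 => /eqP /psumr_eq0P H; apply/eqP/rowP => i.
rewrite mxE; apply/eqP; rewrite -sqrf_eq0 H// => j _; exact: sqr_ge0.
Qed.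

Lemma norm2Z d (a : R) (x : 'rV[R]_d) : 0 <= a -> norm2 (a *: x) = a * norm2 x.
Proof.
move=> a0; rewrite /norm2 (eq_bigr (fun i => a ^+ 2 * x ord0 i ^+ 2)).
  by rewrite -mulr_sumr sqrtrM ?sqr_ge0// sqrtr_sqr ger0_norm.
by move=> i _; rewrite mxE exprMn.
Qed.

Lemma sphereP k (x : 'rV[R]_k.+1) : sphere R k x <-> norm2 x = 1.
Proof.
rewrite /sphere/norm2/=; split=> [->|]; first by rewrite sqrtr1.
by move=> H; rewrite -[LHS]sqr_sqrtr ?sqr_sum_ge0// H expr1n.
Qed.

(** The radial projections onto the Euclidean sphere and onto the boundary of
    the cube, which restrict to mutually inverse homeomorphisms. *)
Definition to_sphere d (x : 'rV[R]_d) : 'rV[R]_d := (norm2 x)^-1 *: x.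
Definition to_cube_bd d (x : 'rV[R]_d) : 'rV[R]_d := `|x|^-1 *: x.

Lemma cube_bd_neq0 d (x : 'rV[R]_d) : cube_bd d x -> x != 0.
Proof. by move=> x1; rewrite -normr_gt0 x1. Qed.

Lemma sphere_neq0 k (x : 'rV[R]_k.+1) : sphere R k x -> x != 0.
Proof.
move=> /sphereP; apply: contraPneq => ->.
have -> : 0 = 0 *: (0 : 'rV[R]_k.+1) by rewrite scale0r.
by rewrite norm2Z// mul0r; lra.
Qed.

Lemma to_sphere_in k (x : 'rV[R]_k.+1) : x != 0 -> sphere R k (to_sphere x).
Proof.
move=> x0; have n0 := norm2_gt0 x0.
by apply/sphereP; rewrite norm2Z ?invr_ge0 ?ltW// mulVf ?gt_eqF.
Qed.

Lemma to_cube_bd_in d (x : 'rV[R]_d) : x != 0 -> cube_bd d (to_cube_bd x).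
Proof.
rewrite -normr_gt0 => x0.
by rewrite /cube_bd/= normrZ normfV normr_id mulVf ?gt_eqF.
Qed.

Lemma to_sphereK d (x : 'rV[R]_d) : cube_bd d x -> to_cube_bd (to_sphere x) = x.
Proof.
move=> x1; have n0 := norm2_gt0 (cube_bd_neq0 x1).
rewrite /to_cube_bd/to_sphere normrZ x1 mulr1 scalerA normfV invrK.
by rewrite gtr0_norm// mulfV ?scale1r// gt_eqF.
Qed.

Lemma to_cube_bdK k (x : 'rV[R]_k.+1) : sphere R k x -> to_sphere (to_cube_bd x) = x.
Proof.
move=> x1; have := sphere_neq0 x1; rewrite -normr_gt0 => n0.
rewrite /to_cube_bd/to_sphere norm2Z ?invr_ge0// (sphereP x).1// mulr1 invrK.
by rewrite scalerA mulfV ?scale1r// gt_eqF.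
Qed.

Lemma to_sphere_continuous d (x : 'rV[R]_d) : x != 0 ->
  {for x, continuous (@to_sphere d)}.
Proof.
move=> x0; have cV : (norm2 y)^-1 @[y --> x] --> (norm2 x)^-1.
  by apply: (@cvgV _ _ (nbhs x) _); [apply: lt0r_neq0; exact: norm2_gt0|exact: norm2_continuous].
exact: (@cvgZ _ _ _ (nbhs x) _ _ _ _ _ cV cvg_id).
Qed.

Lemma to_cube_bd_continuous d (x : 'rV[R]_d) : x != 0 ->
  {for x, continuous (@to_cube_bd d)}.
Proof.
move=> x0; have cV : `|y|^-1 @[y --> x] --> `|x|^-1.
  by apply: (@cvgV _ _ (nbhs x) _); [rewrite normr_eq0|exact: norm_continuous].
exact: (@cvgZ _ _ _ (nbhs x) _ _ _ _ _ cV cvg_id).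
Qed.

Lemma within_at (X Y : topologicalType) (A : set X) (f : X -> Y) :
  (forall x, A x -> {for x, continuous f}) -> {within A, continuous f}.
Proof. by move=> H; apply: continuous_in_subspaceT => x /set_mem; exact: H. Qed.

Definition fillable (Y : topologicalType) d (U : set Y) (h : 'rV[R]_d -> Y) :=
  exists g : 'rV[R]_d -> Y, [/\ {within cube d, continuous g},
    forall x, cube d x -> U (g x) & forall x, cube_bd d x -> g x = h x].

(** Shrinking the cube to its centre contracts its boundary inside the filling. *)
Lemma fillable_null_homotopic (Y : topologicalType) k (U : set Y)
    (f : 'rV[R]_k.+1 -> Y) :
  fillable U (fun x => f (to_sphere x)) -> null_homotopic_in U f.
Proof.
move=> [g [cg gU gf]].
exists (fun p => g ((1 - p.1) *: to_cube_bd p.2)), (g 0).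
have incube (p : R * 'rV[R]_k.+1) : (`[0, 1] `*` sphere R k) p ->
    cube k.+1 ((1 - p.1) *: to_cube_bd p.2).
  move=> [/=]; rewrite in_itv/= => /andP[p0 p1] ps.
  have n1 : `|to_cube_bd p.2| = 1 by exact/to_cube_bd_in/sphere_neq0.
  by rewrite /cube/= normrZ n1 mulr1 ger0_norm; lra.
split.
- apply: (within_comp incube) cg.
  apply: within_at => -[t x] [_ /sphere_neq0/= x0].
  apply: cvgZ; first by apply: cvgB; [exact: cvg_cst|exact: cvg_fst].
  apply: (@continuous_comp _ _ _ snd) => /=; first exact: cvg_snd.
  exact: to_cube_bd_continuous.
- by move=> _ [p /incube pc <-]; exact: gU.
- move=> x x1; rewrite /= subr0 scale1r gf; first by rewrite to_cube_bdK.
  by apply/to_cube_bd_in/sphere_neq0.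
- by move=> x x1; rewrite /= subrr scale0r.
Qed.

(** The homotopy runs through the collar between the half-size cube and the
    boundary; its constant final value fills the half-size cube, so there is no
    continuity to check at the centre. *)
Lemma null_homotopic_fillable (Y : metricType R) k (U : set Y)
    (h : 'rV[R]_k.+1 -> Y) :
  null_homotopic_in U (fun y => h (to_cube_bd y)) -> fillable U h.
Proof.
move=> [H [c [cH HU H0 H1]]].
pose phi (x : 'rV[R]_k.+1) := (2 * (1 - `|x|), to_sphere x).
pose A : set 'rV[R]_k.+1 := [set x | 1 / 2 <= `|x|].
have in_dom x : (cube k.+1 `&` A) x -> (`[0, 1] `*` sphere R k) (phi x).
  rewrite /cube/A/= => -[x1 x2]; split => /=.
    by rewrite in_itv/=; apply/andP; split; lra.
  by apply: to_sphere_in; rewrite -normr_gt0; lra.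
pose g x := if `|x| <= 1 / 2 then c else H (phi x).
have gA x : (cube k.+1 `&` A) x -> H (phi x) = g x.
  move=> /[dup] /in_dom[_ /= xs] [x1 x2]; rewrite /g; case: ifPn => // x3.
  have xE : `|x| = 1 / 2 by apply/eqP; rewrite eq_le x3.
  by rewrite -(H1 _ xs); congr (H (_, _)); rewrite xE; lra.
exists g; split.
- apply: (@within_paste2 _ _ _ [set x | `|x| <= 1 / 2] A).
  + apply: (@closed_comp _ _ (fun x : 'rV[R]_k.+1 => `|x| : R) [set r | r <= 1 / 2]).
      by move=> x _; exact: norm_continuous.
    exact: closed_le.
  + apply: (@closed_comp _ _ (fun x : 'rV[R]_k.+1 => `|x| : R) [set r | 1 / 2 <= r]).
      by move=> x _; exact: norm_continuous.
    exact: closed_ge.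
  + by move=> x _; rewrite /A/=; case: (leP `|x| (1 / 2)) => [|/ltW]; [left|right].
  + apply: (@within_eq _ _ _ (fun=> c)); last exact: within_cst.
    by move=> x [_ /= x2]; rewrite /g x2.
  + apply: (within_eq gA); apply: (within_comp in_dom) cH.
    apply: within_at => x [_ x2]; have x0 : x != 0.
      by rewrite -normr_gt0; move: x2; rewrite /A/=; lra.
    have c1 : 2 * (1 - `|y|) @[y --> x] --> 2 * (1 - `|x|).
      apply: (@cvgM _ _ (nbhs x) _); first exact: cvg_cst.
      by apply: (@cvgB _ _ _ (nbhs x) _); [exact: cvg_cst|exact: norm_continuous].
    exact: cvg_pair c1 (to_sphere_continuous x0).
- move=> x x1; have [x2|x2] := leP `|x| (1 / 2).
    have s1 : sphere R k (to_sphere (const_mx 1)).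
      exact/to_sphere_in/cube_bd_neq0/cube_bd_const1.
    rewrite /g x2 -(H1 _ s1); apply: HU; exists (1, to_sphere (const_mx 1)) => //.
    by split => //=; rewrite in_itv/= ler01 lexx.
  have xA : (cube k.+1 `&` A) x by split => //; exact: ltW.
  by rewrite -gA//; apply: HU; exists (phi x) => //; exact: in_dom.
- move=> x x1; have xA : (cube k.+1 `&` A) x.
    by split; [exact: cube_bd_sub|rewrite /A/= x1; lra].
  rewrite -gA// /phi x1 subrr mulr0 H0 ?to_sphereK//.
  exact/to_sphere_in/cube_bd_neq0.
Qed.

Lemma within_to_sphere (Y : topologicalType) k (f : 'rV[R]_k.+1 -> Y) :
  {within sphere R k, continuous f} ->
  {within cube_bd k.+1, continuous (fun x => f (to_sphere x))}.
Proof.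
apply: within_comp => [x /cube_bd_neq0 /to_sphere_in//|].
by apply: within_at => x /cube_bd_neq0; exact: to_sphere_continuous.
Qed.

Lemma within_to_cube_bd (Y : topologicalType) k (h : 'rV[R]_k.+1 -> Y) :
  {within cube_bd k.+1, continuous h} ->
  {within sphere R k, continuous (fun x => h (to_cube_bd x))}.
Proof.
apply: within_comp => [x /sphere_neq0 /to_cube_bd_in//|].
by apply: within_at => x /sphere_neq0; exact: to_cube_bd_continuous.
Qed.

End Cubes.
Arguments cube {R} d _.
Arguments cube_bd {R} d _.

(** * Cubical grids *)

Section Grid.
Context {R : realType} (d N : nat).

(** The cube is cut into [N.+1] parts along every axis and [grid_coord]
    identifies it with the product of the intervals from 0 to [2 * N.+1].  An
    even entry of a cell stands for the point with that coordinate and an odd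
    entry [a] for the interval of radius 1 around [a]; hence the radius
    [odd (c i)] in [ccell]. *)
Definition cell := {ffun 'I_d -> 'I_(2 * N.+1).+1}.

Definition grid_coord (x : 'rV[R]_d) (i : 'I_d) : R := N.+1%:R * (x ord0 i + 1).

Definition ccell (c : cell) : set 'rV[R]_d :=
  [set x | forall i, `|grid_coord x i - (c i : nat)%:R| <= (odd (c i))%:R].

Definition ocell (c : cell) : set 'rV[R]_d :=
  [set x | ccell c x /\ forall i, odd (c i) -> `|grid_coord x i - (c i : nat)%:R| < 1].

Definition cdim (c : cell) : nat := #|[set i | odd (c i)]%SET|.

Lemma gridN_gt0 : 0 < N.+1%:R :> R. Proof. by rewrite ltr0n. Qed.
#[local] Hint Resolve gridN_gt0 : core.

Lemma ocell_sub c : ocell c `<=` ccell c. Proof. by move=> x []. Qed.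

Lemma grid_coord_cvg i : continuous (fun x => grid_coord x i).
Proof.
move=> x; apply: (@cvgM _ _ (nbhs x) _); first exact: cvg_cst.
apply: (@cvgD _ _ _ (nbhs x) _); last exact: cvg_cst.
exact: coord_continuous.
Qed.

Lemma closed_ccell c : closed (ccell c).
Proof.
have -> : ccell c = \bigcap_(i in [set: 'I_d])
    [set x | `|grid_coord x i - (c i : nat)%:R| <= (odd (c i))%:R].
  by apply/seteqP; split => x /= H i; [move=> _|]; exact: H.
apply: closed_bigI => i _.
apply: (@closed_comp _ _ (fun x => `|grid_coord x i - (c i : nat)%:R|)
    [set r | r <= (odd (c i))%:R]); last exact: closed_le.
move=> x _; apply: (@cvg_norm _ _ _ (nbhs x) _).
apply: (@cvgB _ _ _ (nbhs x) _); last exact: cvg_cst.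
exact: grid_coord_cvg.
Qed.

Lemma in_cubeP (x : 'rV[R]_d) :
  cube d x <-> forall i, 0 <= grid_coord x i <= (2 * N.+1)%:R.
Proof.
rewrite natrM mulrC; split.
  move=> /(rv_norm_leP _ ler01) H i; have := H i.
  rewrite ler_norml => /andP[x1 x2]; rewrite /grid_coord.
  by rewrite ler_pM2l// mulr_ge0//=; lra.
move=> H; apply/(rv_norm_leP _ ler01) => i; have := H i.
rewrite /grid_coord pmulr_rge0// ler_pM2l// ler_norml => /andP[x1 x2].
by apply/andP; split; lra.
Qed.

Lemma cell_coord_odd (c : cell) i : odd (c i) -> (0 < c i < 2 * N.+1)%N.
Proof. by move=> oc; have := ltn_ord (c i); lia. Qed.

Lemma cell_coord_oddR (c : cell) i : odd (c i) ->
  1 <= (c i : nat)%:R :> R /\ (c i : nat)%:R + 1 <= (2 * N.+1)%:R :> R.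
Proof. by move=> /cell_coord_odd /andP[a b]; rewrite ler1n natr1 ler_nat. Qed.

Lemma ccell_cube c : ccell c `<=` cube d.
Proof.
move=> x cx; apply/in_cubeP => i; have := cx i.
have [oc|ec] := boolP (odd (c i)).
  have [a b] := cell_coord_oddR oc.
  by rewrite ler_norml /= => /andP[u v]; apply/andP; split; lra.
have := ltn_ord (c i); rewrite ltnS -(ler_nat R) ler_norml /= => a /andP[u v].
by have := ler0n R (c i); move=> ?; apply/andP; split; lra.
Qed.

Lemma coord_cell_exists (t : R) m : 0 <= t <= (2 * m)%:R ->
  exists2 a, (a <= 2 * m)%N & `|t - a%:R| <= (odd a)%:R /\ (odd a -> `|t - a%:R| < 1).
Proof.
move=> /andP[t0 tm]; pose k := Num.truncn t.
have /andP[kt tk] := truncn_itv t0; rewrite -/k -natr1 in kt tk.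
have km : (k <= 2 * m)%N by rewrite -(ler_nat R); exact: le_trans kt tm.
have [ok|ek] := boolP (odd k).
  have H : `|t - k%:R| < 1 by rewrite ltr_norml; lra.
  by exists k => //; rewrite ok /=; split => // ; exact: ltW.
have [->|tk0] := eqVneq t k%:R.
  by exists k => //; rewrite (negPf ek) subrr normr0.
have {}kt : k%:R < t by rewrite lt_neqAle eq_sym tk0.
exists k.+1.
  suff : (k < 2 * m)%N by [].
  by rewrite -(ltr_nat R); exact: lt_le_trans kt tm.
have H : `|t - k.+1%:R| < 1 by rewrite ltr_norml -natr1; lra.
by rewrite /= ek /=; split => //; exact: ltW.
Qed.

Lemma ocell_exists x : cube d x -> exists c, ocell c x.
Proof.
move=> /in_cubeP H.
have /choice[f Hf] : forall i, exists a : 'I_(2 * N.+1).+1,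
    `|grid_coord x i - (a : nat)%:R| <= (odd a)%:R /\
    (odd a -> `|grid_coord x i - (a : nat)%:R| < 1).
  move=> i; have [a am Ha] := coord_cell_exists (H i).
  by rewrite -ltnS in am; exists (Ordinal am).
by exists [ffun i => f i]; split=> i; rewrite ffunE; have [] := Hf i.
Qed.

Lemma coord_eq_odd (t : R) (a b : nat) : odd a ->
  `|t - a%:R| < 1 -> `|t - b%:R| <= (odd b)%:R -> b = a.
Proof.
move=> oa; rewrite ltr_norml ler_norml => /andP[h1 h2] /andP[h3 h4].
have [ob|eb] := boolP (odd b).
  rewrite ob /= in h3 h4.
  have : (b < a + 2)%N by rewrite -(ltr_nat R) natrD; lra.
  have : (a < b + 2)%N by rewrite -(ltr_nat R) natrD; lra.
  by lia.
rewrite (negPf eb) /= in h3 h4.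
have : (b < a + 1)%N by rewrite -(ltr_nat R) natrD; lra.
have : (a < b + 1)%N by rewrite -(ltr_nat R) natrD; lra.
by lia.
Qed.

Lemma coord_even (t : R) (a : nat) : ~~ odd a ->
  `|t - a%:R| <= (odd a)%:R -> t = a%:R.
Proof. by move=> /negPf -> /=; rewrite normr_le0 subr_eq0 => /eqP. Qed.

(** Along an odd entry of [c] the entries of the two cells agree; along an even
    entry [c] is reduced to the coordinate of [x]. *)
Lemma ocell_face c c1 x : ocell c x -> ccell c1 x -> ccell c `<=` ccell c1.
Proof.
move=> [cx ox] c1x y cy i.
have [oc|ec] := boolP (odd (c i)).
  by rewrite (coord_eq_odd oc (ox i oc) (c1x i)); exact: cy.
by have := c1x i; rewrite (coord_even ec (cx i)) (coord_even ec (cy i)).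
Qed.

Lemma ocell_odd_sub c c1 x : ocell c x -> ccell c1 x ->
  [set i | odd (c i)]%SET \subset [set i | odd (c1 i)]%SET.
Proof.
move=> [cx ox] c1x; apply/fintype.subsetP => i; rewrite !inE => oc.
by rewrite (coord_eq_odd oc (ox i oc) (c1x i)).
Qed.

Lemma ocell_dim c c1 x : ocell c x -> ccell c1 x -> (cdim c <= cdim c1)%N.
Proof. by move=> cx c1x; apply: subset_leq_card; exact: ocell_odd_sub cx c1x. Qed.

(** Every odd entry of [c] is one of [c1], so equal dimensions force the same
    directions, and then the same entries. *)
Lemma ocell_uniq c c1 x : ocell c x -> ccell c1 x -> (cdim c1 <= cdim c)%N -> c1 = c.
Proof.
move=> ocx c1x dc; have := ocell_odd_sub ocx c1x; case: ocx => cx ox s.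
have /eqP E : [set i | odd (c i)]%SET == [set i | odd (c1 i)]%SET by rewrite eqEcard s.
apply/ffunP => i; apply/val_inj => /=.
have [oc|ec] := boolP (odd (c i)); first exact: coord_eq_odd oc (ox i oc) (c1x i).
have ec1 : ~~ odd (c1 i).
  by have /setP/(_ i) := E; rewrite !inE (negPf ec) => <-.
apply/eqP; rewrite -(eqr_nat R).
by rewrite -(coord_even ec (cx i)) -(coord_even ec1 (c1x i)).
Qed.

Lemma ccell_bd c x : ccell c x -> ~ ocell c x ->
  exists c', [/\ ocell c' x, (cdim c' < cdim c)%N & ccell c' `<=` ccell c].
Proof.
move=> cx nox; have [c' oc'] := ocell_exists (ccell_cube cx).
exists c'; split => //; last exact: ocell_face oc' cx.
rewrite ltnNge; apply/negP => le.
by have E := ocell_uniq oc' cx le; apply: nox; rewrite E.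
Qed.

Lemma ccell_mesh c x y : ccell c x -> ccell c y -> `|x - y| <= 2 / N.+1%:R.
Proof.
move=> cx cy; apply/rv_norm_leP => [|i]; first by rewrite divr_ge0.
rewrite ler_pdivlMr// -(gtr0_norm gridN_gt0) -normrM.
have := cx i; have := cy i; rewrite !mxE /grid_coord.
have : (odd (c i))%:R <= 1 :> R by case: odd; rewrite ?ler01 ?lexx.
move: (nat_of_bool _)%:R => o o1; rewrite !ler_norml => /andP[a b] /andP[e f].
by apply/andP; split; nra.
Qed.

(** Rounding every odd entry down to an even one gives a vertex of [c]. *)
Lemma vertex_exists c : exists v x, [/\ cdim v = 0%N, ccell v x & ccell v `<=` ccell c].
Proof.
have vlt i : (c i - odd (c i) < (2 * N.+1).+1)%N.
  by apply: leq_ltn_trans (leq_subr _ _) (ltn_ord _).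
have ev i : ~~ odd (c i - odd (c i)) by lia.
pose v : cell := [ffun i => Ordinal (vlt i)].
have vE i : v i = (c i - odd (c i))%N :> nat by rewrite ffunE.
exists v, (\row_i ((v i : nat)%:R / N.+1%:R - 1)); split.
- by apply: eq_card0 => i; rewrite !inE vE (negPf (ev i)).
- move=> i; rewrite /grid_coord !mxE subrK mulrCA divff ?gt_eqF// mulr1 subrr normr0.
  by rewrite ler0n.
- move=> y vy i; have := vy i; rewrite vE (negPf (ev i)) /= normr_le0 subr_eq0 => /eqP ->.

  have [oc|ec] := boolP (odd (c i)); last by rewrite subn0 subrr normr0.
  have c0 : (0 < c i)%N by case: (c i : nat) oc.
  by rewrite natrB// addrAC subrr add0r normrN1.
Qed.

Lemma ccell_dim0 c x y : cdim c = 0%N -> ccell c x -> ccell c y -> x = y.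
Proof.
move=> /eqP; rewrite cards_eq0 => /eqP c0 cx cy; apply/rowP => i.
have ec : ~~ odd (c i) by have /setP/(_ i) := c0; rewrite !inE => ->.
have := coord_even ec (cx i); rewrite -(coord_even ec (cy i)) /grid_coord.
by move=> /(mulfI (lt0r_neq0 gridN_gt0))/addIr.
Qed.

Lemma cell_coord_bd (c : cell) x i : ocell c x -> `|x ord0 i| = 1 ->
  ~~ odd (c i) /\ forall y, ccell c y -> `|y ord0 i| = 1.
Proof.
move=> [cx ox] x1.
have xE : grid_coord x i = 0 \/ grid_coord x i = (2 * N.+1)%:R.
  have /orP[/eqP xi|/eqP xi] : (x ord0 i == 1) || (x ord0 i == -1).
  - by rewrite -eqr_norm2 x1 normr1 eqxx.
  - by right; rewrite /grid_coord xi natrM mulrC.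
  - by left; rewrite /grid_coord xi addNr mulr0.
have ec : ~~ odd (c i).
  apply/negP => oc; have := ox i oc; have [a b] := cell_coord_oddR oc.
  by rewrite ltr_norml; case: xE => -> /andP[u v]; lra.
split=> // y cy; have := coord_even ec (cx i).
rewrite -(coord_even ec (cy i)) /grid_coord.
by move=> /(mulfI (lt0r_neq0 gridN_gt0))/addIr <-.
Qed.

(** The boundary of the cube is a union of cells, because its equations put a
    grid coordinate at 0 or at [2 * N.+1], which are even, so that the cell has
    that entry. *)
Lemma ocell_cube_bd c x : ocell c x -> cube_bd d x -> ccell c `<=` cube_bd d.
Proof.
move=> ox x1 y cy; have x0 : 0 < `|x| by rewrite x1.
have [i xi] := rv_norm_attained x0; rewrite x1 in xi.
have [_ /(_ y cy) yi] := cell_coord_bd ox xi.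
apply/eqP; rewrite eq_le (ccell_cube cy)/= -yi; exact: rv_coord_le.
Qed.

Lemma ocell_cube_bd_dim c x : ocell c x -> cube_bd d x -> (cdim c < d)%N.
Proof.
move=> ox x1; have x0 : 0 < `|x| by rewrite x1.
have [i xi] := rv_norm_attained x0; rewrite x1 in xi.
have [ec _] := cell_coord_bd ox xi.
rewrite -[ltnRHS]card_ord -cardsT; apply: proper_card.
rewrite properT; apply: contraNneq ec => /setP/(_ i).
by rewrite !inE => ->.
Qed.

(** Rounding an even entry to a neighboring odd one enlarges the cell. *)
Lemma top_exists x : cube d x -> exists2 c : cell, (forall i, odd (c i)) & ccell c x.
Proof.
move=> /ocell_exists [c [cx _]].
pose f i := if odd (c i) then (c i : nat) else if c i == 0%N :> nat then 1%N else (c i).-1.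
have flt i : (f i < (2 * N.+1).+1)%N.
  by have := ltn_ord (c i); rewrite /f; case: ifP => //; case: eqP; lia.
exists [ffun i => Ordinal (flt i)] => i; rewrite ffunE /= /f.
  by have := ltn_ord (c i); case: ifP => //; case: eqP; lia.
case: ifPn => [oc|ec]; first by have := cx i; rewrite oc.
rewrite (coord_even ec (cx i)); case: eqP => [->|/eqP c0].
  by rewrite sub0r normrN /= normr1.
have {1}-> : (c i : nat) = (c i).-1.+1 by lia.
rewrite -natr1 addrAC subrr add0r normr1.
by have -> : odd (c i).-1 by lia.
Qed.

(** ** Parametrization of a cell by a standard cube *)
(** The map [v] lists the directions in which [c] extends.  It is a parameter
    because a cell of full dimension has to be parametrized by a cube of exactly
    the same dimension as the ambient one, with [v] the identity. *)
Section Param.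
Variables (c : cell) (j : nat) (v : 'I_j -> 'I_d).
Hypothesis v_inj : injective v.
Hypothesis v_odd : forall i, odd (c i) <-> exists a, v a = i.

Definition cell_param (u : 'rV[R]_j) : 'rV[R]_d :=
  \row_i (((c i : nat)%:R +
    (if [pick a | v a == i] is Some a then u ord0 a else 0)) / N.+1%:R - 1).

Definition cell_chart (x : 'rV[R]_d) : 'rV[R]_j :=
  \row_a (grid_coord x (v a) - (c (v a) : nat)%:R).

Lemma cell_param_coord u i : grid_coord (cell_param u) i - (c i : nat)%:R =
  if [pick a | v a == i] is Some a then u ord0 a else 0.
Proof.
rewrite /grid_coord mxE subrK mulrCA divff ?gt_eqF// mulr1.
by rewrite addrAC subrr add0r.
Qed.

Lemma cell_param_coordv u a :
  grid_coord (cell_param u) (v a) - (c (v a) : nat)%:R = u ord0 a.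
Proof.
rewrite cell_param_coord; case: pickP => [b /eqP/v_inj->//|/(_ a)].
by rewrite eqxx.
Qed.

Lemma cell_paramP u : cube j u -> ccell c (cell_param u).
Proof.
move=> u1 i; rewrite cell_param_coord; case: pickP => [a /eqP va|_].
  have -> : odd (c i) by apply/v_odd; exists a.
  by apply: le_trans (rv_coord_le _ _) _.
by rewrite normr0 ler0n.
Qed.

Lemma cell_param_bd u : cube_bd j u -> ~ ocell c (cell_param u).
Proof.
move=> u1 [_ ox]; have u0 : 0 < `|u| by rewrite u1.
have [a ua] := rv_norm_attained u0; rewrite u1 in ua.
have /ox : odd (c (v a)) by apply/v_odd; exists a.
by rewrite cell_param_coordv ua ltxx.
Qed.

Lemma cell_chartP x : ccell c x -> cube j (cell_chart x).
Proof.
move=> cx; apply/(rv_norm_leP _ ler01) => a; rewrite mxE.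
by apply: le_trans (cx _) _; case: odd; rewrite ?ler01.
Qed.

Lemma cell_chart_bd x : ccell c x -> ~ ocell c x -> cube_bd j (cell_chart x).
Proof.
move=> cx nox; apply/eqP; rewrite eq_le (cell_chartP cx) /= leNgt.
apply/negP => lt1; apply: nox; split => // i /v_odd [a <-].
by apply: le_lt_trans lt1; have := rv_coord_le (cell_chart x) a; rewrite mxE.
Qed.

Lemma cell_chartK x : ccell c x -> cell_param (cell_chart x) = x.
Proof.
move=> cx; apply/rowP => i.
have N0 : N.+1%:R != 0 :> R by rewrite gt_eqF.
have E : grid_coord (cell_param (cell_chart x)) i = grid_coord x i.
  apply/eqP; rewrite -(inj_eq (addIr (- (c i : nat)%:R))) cell_param_coord.
  case: pickP => [a /eqP <-|H]; first by rewrite mxE.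
  have ec : ~~ odd (c i).
    by apply/negP => /v_odd [a va]; have := H a; rewrite va eqxx.
  by rewrite (coord_even ec (cx i)) subrr.
by move: E; rewrite /grid_coord => /(mulfI N0)/addIr.
Qed.

Lemma lipschitz_continuous m n (f : 'rV[R]_m -> 'rV[R]_n) (K : R) :
  0 < K -> (forall x y, `|f x - f y| <= K * `|x - y|) -> continuous f.
Proof.
move=> K0 H x; apply/(@cvgrPdist_le _ _ _ (nbhs x) _) => e e0; near=> y.
apply: le_trans (H _ _) _; rewrite mulrC -ler_pdivlMr//.
near: y; apply: cvgr_dist_le; first exact: cvg_id.
by rewrite divr_gt0.
Unshelve. all: by end_near. Qed.

Lemma cell_param_continuous : continuous cell_param.
Proof.
apply: (@lipschitz_continuous _ _ _ 1) => // x y; rewrite mul1r.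
apply/rv_norm_leP => // i; rewrite !mxE.
have -> (a b : R) : (a / N.+1%:R - 1) - (b / N.+1%:R - 1) = (a - b) / N.+1%:R by ring.
rewrite normrM normfV (gtr0_norm gridN_gt0) ler_pdivrMr//.
rewrite opprD addrACA subrr add0r.
apply: (@le_trans _ _ `|x - y|); last by rewrite ler_peMr// ler1n.
case: pickP => [a _|_]; last by rewrite subrr normr0.
by have := rv_coord_le (x - y) a; rewrite !mxE.
Qed.

Lemma cell_chart_continuous : continuous cell_chart.
Proof.
apply: (@lipschitz_continuous _ _ _ N.+1%:R) => // x y.
apply/rv_norm_leP => [|a]; first by rewrite mulr_ge0.
rewrite !mxE /grid_coord.
have -> (s t r : R) : N.+1%:R * (s + 1) - r - (N.+1%:R * (t + 1) - r) = N.+1%:R * (s - t) by ring.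
rewrite normrM (gtr0_norm gridN_gt0) ler_pM2l//.
by have := rv_coord_le (x - y) (v a); rewrite !mxE.
Qed.

End Param.

End Grid.

(** * Filling cells and skeleta *)

Section Skeleton.
Context {R : realType}.

Definition fills (Y : topologicalType) d (V U : set Y) :=
  forall h : 'rV[R]_d -> Y, {within cube_bd d, continuous h} ->
    (forall x, cube_bd d x -> V (h x)) -> fillable U h.

Lemma fillsS (Y : topologicalType) d (V V' U U' : set Y) :
  V' `<=` V -> U `<=` U' -> fills d V U -> fills d V' U'.
Proof.
move=> VV UU H h ch hV; have [g [cg gU gh]] := H h ch (fun x x1 => VV _ (hV x x1)).
by exists g; split => // x x1; apply/UU/gU.
Qed.

(** The chart carries the pair formed by the cell and its frontier to a standard
    cube and its boundary. *)
Lemma cell_fill (Y : topologicalType) d N (c : cell d N) (V U : set Y)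
    (h : 'rV[R]_d -> Y) :
  fills (cdim c) V U ->
  {within ccell c `\` ocell c, continuous h} ->
  (forall x, ccell c x -> ~ ocell c x -> V (h x)) ->
  exists e : 'rV[R]_d -> Y, [/\ {within ccell c, continuous e},
    forall x, ccell c x -> U (e x) &
    forall x, ccell c x -> ~ ocell c x -> e x = h x].
Proof.
move=> F ch hV; pose v (a : 'I_(cdim c)) : 'I_d := enum_val a.
have v_inj : injective v by exact: enum_val_inj.
have v_odd i : odd (c i) <-> exists a, v a = i.
  split=> [oc|[a <-]]; last by have := enum_valP a; rewrite inE.
  have ic : i \in [set i | odd (c i)]%SET by rewrite inE.
  by exists (enum_rank_in ic i); rewrite /v enum_rankK_in.
have [|u ub|g [cg gU gh]] := F (fun u => h (cell_param c v u)).
- apply: (within_comp (f := cell_param c v) _ _ ch) => [u ub|]; last first.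
    by apply: within_continuous; exact: cell_param_continuous.
  split; last exact: cell_param_bd ub.
  by apply: (cell_paramP v_odd); exact: cube_bd_sub.
- apply: hV; last exact: cell_param_bd ub.
  by apply: (cell_paramP v_odd); exact: cube_bd_sub.
exists (fun x => g (cell_chart c v x)); split.
- apply: (within_comp (f := cell_chart c v) _ _ cg) => [x cx|]; first exact: cell_chartP.
  by apply: within_continuous; exact: cell_chart_continuous.
- by move=> x cx; apply: gU; exact: cell_chartP.
- move=> x cx nox; rewrite gh; last exact: (cell_chart_bd v_odd).
  by rewrite (cell_chartK v_odd).
Qed.

(** Local connectedness indexed by the dimension of the cubes to be filled, which
    exceeds by one the dimension of the spheres.  At [n = 0] it is vacuous and
    starts inductions. *)
Definition LC_cube n (M : metricType R) :=
  forall (x : M) (U : set M), open U -> U x ->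
  exists2 V : set M, nbhs x V &
    forall d, (0 < d <= n)%N -> fills d V U.

Lemma LC_cubeP n (M : metricType R) : LC R n M <-> LC_cube n.+1 M.
Proof.
split=> lc x U oU Ux; have [V Vx HV] := lc x U oU Ux; exists V => //.
  move=> [//|k]; rewrite ltnS => /andP[_ kn] h ch hV.
  apply: null_homotopic_fillable; apply: (HV k kn); split.
    exact: within_to_cube_bd.
  by move=> _ [y /sphere_neq0/to_cube_bd_in/hV Vy <-].
move=> k kn f [cf fV]; apply: fillable_null_homotopic.
apply: (HV k.+1) => //; first exact: within_to_sphere.
move=> x1 x1b; apply: fV; exists (to_sphere x1) => //.
exact/to_sphere_in/cube_bd_neq0.
Qed.

(** The factor 8 leaves room for comparing the values of [a] at several nearby
    points. *)
Lemma gauge_fills n (M : metricType R) (a : M -> R) :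
  LC_cube n M -> gauge a ->
  exists2 b : M -> R, gauge b & forall x, b x <= a x / 8 /\
    forall d, (0 < d <= n)%N -> fills d (mball x (b x)) (mball x (a x / 8)).
Proof.
move=> lc [a0 aL].
apply: (@gauge_inf _ _ (fun x r => r <= a x / 8 /\
  forall d, (0 < d <= n)%N -> fills d (mball x r) (mball x (a x / 8))))
  => [x r s sr [ra H]|x].
  split=> [|d dn]; first by apply: le_trans sr ra.
  by apply: fillsS (H d dn) => // y; rewrite /mball/= => /lt_le_trans; apply.
have ax := a0 x.
have Ux : mball x (a x / 32) x by rewrite /mball/= mdistxx; lra.
have [V /nbhs_mballP[r r0 rV] HV] := lc x _ (@open_mball _ _ x _) Ux.
exists (Num.min (r / 2) (a x / 32)) => [|y]; first by rewrite lt_min; apply/andP; split; lra.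
rewrite lt_min => /andP[xy1 xy2]; have := aL x y => axy.
split=> [|d /HV]; first by rewrite ge_min; apply/orP; right; lra.
apply: fillsS => z; rewrite /mball/=.
  rewrite lt_min => /andP[yz _]; apply: rV; rewrite /mball/=.
  by have := metric_triangle x y z; lra.
by move=> xz; have := metric_triangle y x z; rewrite (metric_sym y x); lra.
Qed.

Section Skel.
Variables (d N : nat) (K X : set 'rV[R]_d).

(** The set [K] is the part of the cube where a map is given in advance, and [X]
    is the subcomplex over which it is to be extended. *)
Definition skel (j : nat) : set 'rV[R]_d :=
  [set x | K x \/ exists c : cell d N,
    [/\ (cdim c <= j)%N, ccell c `<=` X & ccell c x]].

Definition union_of_cells :=
  forall (c : cell d N) x, ocell c x -> K x -> ccell c `<=` K.

Lemma skelS i j : (i <= j)%N -> skel i `<=` skel j.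
Proof.
move=> ij x [Kx|[c [ci cX cx]]]; [by left|right].
by exists c; split => //; exact: leq_trans ij.
Qed.

(** Vertices are isolated, so they impose no condition. *)
Lemma skel0_continuous (M : metricType R) (h : 'rV[R]_d -> M) :
  closed K -> {within K, continuous h} -> {within skel 0, continuous h}.
Proof.
move=> cK ch.
pose F (o : option (cell d N)) : set 'rV[R]_d := if o is Some c then
  if cdim c == 0%N then ccell c else set0 else K.
apply: (within_paste (F := F)) => [[c|//]|x [Kx|[c [c0 _ cx]]]|[c|]]; last 1 first.
- by apply: continuous_subspaceW ch => x [].
- rewrite /F; case: ifP => _; [exact: closed_ccell|exact: closed0].
- by exists None.
- by exists (Some c); rewrite /F -leqn0 c0.
apply/within_oscP => x [_ +] eps eps0; rewrite /F; case: eqP => // c0 cx.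
apply: filterE => y [_ cy].
by rewrite (ccell_dim0 c0 cx cy) mdistxx ltW.
Qed.

Lemma skel_face j (c : cell d N) x :
  ccell c `<=` X -> cdim c = j.+1 -> ccell c x -> ~ ocell c x -> skel j x.
Proof.
move=> cX cj cx nox; right; have [c' [oc' lt sub]] := ccell_bd cx nox.
exists c'; split; [by rewrite -ltnS -cj|exact: subset_trans sub cX|exact: ocell_sub].
Qed.

(** Each cell of dimension [j.+1] is filled on its own.  Every new value lies
    within [a / 8] of an old value taken in the same closed cell, and old values
    in one cell are within [a / 8] of each other; as [a] is 1-Lipschitz, the
    images of cells remain [a]-small. *)
Lemma skeleton_step (M : metricType R) (a b : M -> R) j (h : 'rV[R]_d -> M) :
  closed K -> union_of_cells -> gauge a ->
  (forall x, b x <= a x / 8 /\ fills j.+1 (mball x (b x)) (mball x (a x / 8))) ->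
  {within skel j, continuous h} ->
  (forall c : cell d N, ccell c `<=` X -> small b h (ccell c `&` skel j)) ->
  exists h', [/\ forall x, skel j x -> h' x = h x,
    {within skel j.+1, continuous h'} &
    forall c : cell d N, ccell c `<=` X -> small a h' (ccell c `&` skel j.+1)].
Proof.
move=> clK uK [a0 aL] ab ch hb.
have /choice[e He] : forall c : cell d N, exists e : 'rV[R]_d -> M,
    cdim c = j.+1 -> ccell c `<=` X -> [/\ {within ccell c, continuous e},
      forall x, ccell c x -> ~ ocell c x -> e x = h x &
      exists q, (ccell c `&` skel j) q /\
        forall x, ccell c x -> mdist (h q) (e x) < a (h q) / 8].
  move=> c; have [cj|] := eqVneq (cdim c) j.+1; last first.
    by move=> /eqP cj; exists h.
  have [cX|] := pselect (ccell c `<=` X); last by exists h.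
  (* a vertex of [c] serves as the point of its frontier at which sizes are measured *)
  have [v [q [v0 vq vc]]] := @vertex_exists R _ _ c.
  have ncq : ~ ocell c q by move=> /ocell_dim/(_ vq); rewrite v0 cj.
  have cq := vc _ vq.
  have sq := skel_face cX cj cq ncq.
  have [_ fl] := ab (h q); rewrite -cj in fl.
  have [||e [ce eU eh]] := cell_fill (h := h) fl.
  - by apply: continuous_subspaceW ch => x [cx nox]; exact: skel_face cX cj cx nox.
  - move=> x cx nox; apply: (hb c cX q x (conj cq sq)); split => //; exact: skel_face cX cj cx nox.
  by exists e => _ _; split => //; exists q.
pose h' x := if `[< skel j x >] then h x else
  if [pick c : cell d N | `[< [/\ cdim c = j.+1, ccell c `<=` X & ocell c x] >]]
  is Some c then e c x else h x.
have h'h x : skel j x -> h' x = h x by rewrite /h' => sx; rewrite asboolT.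
have h'e c x : cdim c = j.+1 -> ccell c `<=` X -> ccell c x -> ~ skel j x ->
    h' x = e c x.
  move=> cj cX cx ns; rewrite /h' asboolF//.
  have ox : ocell c x by apply: contrapT => nox; apply/ns/(skel_face cX cj cx nox).
  case: pickP => [c2 /asboolP[c2j _ ox2]|/(_ c)/asboolP[]]; last by split.
  by rewrite (ocell_uniq ox2 cx)// cj c2j.
have skelE x : skel j.+1 x -> ~ skel j x ->
    exists c : cell d N, [/\ cdim c = j.+1, ccell c `<=` X & ccell c x].
  move=> [Kx|[c [cj cX cx]]] ns; first by exfalso; apply: ns; left.
  exists c; split => //; apply/eqP; rewrite eqn_leq cj ltnNge.
  by apply/negP => cj'; apply: ns; right; exists c; split.
exists h'; split => //.
- pose F (o : option (cell d N)) : set 'rV[R]_d := if o is Some c then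
    [set x | [/\ (cdim c <= j.+1)%N, ccell c `<=` X & ccell c x]] else K.
  apply: (within_paste (F := F)) => [[c|//]|x [Kx|[c H]]|[c|]]; last 1 first.
  + apply: (@within_eq _ _ _ h) => [x [_ Kx]|]; first by rewrite h'h//; left.
    by apply: continuous_subspaceW ch => x [_ Kx]; left.
  + have [H|H] := pselect ((cdim c <= j.+1)%N /\ ccell c `<=` X).
      have -> : F (Some c) = ccell c by apply/seteqP; case: H => H1 H2; split => x //= [].
      exact: closed_ccell.
    have -> : F (Some c) = set0 by apply/seteqP; split => x //= [H1 H2 _]; apply: H.
    exact: closed0.
  + by exists None.
  + by exists (Some c).
  have [[x [_ [cj cX _]]]|H] := pselect (exists x, (skel j.+1 `&` F (Some c)) x); last first.
    by apply/within_oscP => x Fx; exfalso; apply: H; exists x.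
  have sub : skel j.+1 `&` F (Some c) `<=` ccell c by move=> y [_ []].
  apply: (continuous_subspaceW sub).
  (* a cell of dimension [j.+1] inside [K] keeps its values *)
  have [sk|nsk] := pselect (ccell c `<=` skel j).
    apply: (@within_eq _ _ _ h) => [y cy|]; first by rewrite h'h//; exact: sk.
    exact: continuous_subspaceW ch.
  have {cj} cj : cdim c = j.+1.
    apply/eqP; rewrite eqn_leq cj ltnNge; apply/negP => cj'; apply: nsk => y cy.
    by right; exists c.
  have [ce eh _] := He c cj cX.
  apply: within_eq ce => y cy; have [sy|nsy] := pselect (skel j y).
    rewrite h'h// eh// => oy; apply: nsk => z cz; case: sy => [Ky|[c1 [c1j _ c1y]]].
      by left; exact: uK oy Ky _ cz.
    by have := ocell_dim oy c1y; rewrite cj ltnNge c1j.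
  by rewrite (h'e c).
- move=> c cX p q cp cq.
  have near_skel x : (ccell c `&` skel j.+1) x -> exists y,
      (ccell c `&` skel j) y /\ mdist (h y) (h' x) < a (h y) / 8.
    move=> [cx sx]; have [sjx|nsx] := pselect (skel j x).
      by exists x; split => //; rewrite h'h// mdistxx divr_gt0.
    have [c1 [c1j c1X c1x]] := skelE x sx nsx.
    have [_ _ [y [[c1y sy] Hy]]] := He c1 c1j c1X.
    have ox : ocell c1 x by apply: contrapT => nox; apply/nsx/(skel_face c1X c1j c1x nox).
    exists y; split; last by rewrite (h'e c1)//; exact: Hy.
    by split => //; exact: (ocell_face ox cx).
  have [y [cy Hy]] := near_skel p cp; have [z [cz Hz]] := near_skel q cq.
  have yz := hb c cX y z cy cz; have [ay _] := ab (h y).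
  have L1 := aL (h z) (h y); have L2 := aL (h y) (h' p).
  have T1 := metric_triangle (h' p) (h y) (h' q).
  have T2 := metric_triangle (h y) (h z) (h' q).
  rewrite (metric_sym (h z) (h y)) in L1; rewrite (metric_sym (h' p) (h y)) in T1.
  by have ay0 := a0 (h y); lra.
Qed.

End Skel.

(** The gauges are chosen downwards, from the size wanted on the [n]-skeleton to
    the size required of the vertices. *)
Lemma skeleton_extension n (M : metricType R) (a : M -> R) :
  LC_cube n M -> gauge a ->
  exists b : M -> R, [/\ gauge b, forall x, b x <= a x &
    forall d N (K X : set 'rV[R]_d) (h : 'rV[R]_d -> M),
      closed K -> union_of_cells N K -> {within skel N K X 0, continuous h} ->
      (forall c : cell d N, ccell c `<=` X -> small b h (ccell c `&` skel N K X 0)) ->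
      exists h', [/\ forall x, skel N K X 0 x -> h' x = h x,
        {within skel N K X n, continuous h'} &
        forall c : cell d N, ccell c `<=` X -> small a h' (ccell c `&` skel N K X n)]].
Proof.
move=> lc; have : (n <= n)%N by []; move: {-2}n => j.
elim: j a => [|j IH] a jn ga.
  by exists a; split => // d N K X h _ _ ch hs; exists h.
have [b1 gb1 Hb1] := gauge_fills lc ga.
have [b [gb bb1 Hb]] := IH b1 (ltnW jn) gb1.
exists b; split => // [x|d N K X h cK uK ch hs].
  by apply: le_trans (bb1 x) _; have [] := Hb1 x; have := ga.1 x; lra.
have [h1 [h1h ch1 h1s]] := Hb d N K X h cK uK ch hs.
have [x|h2 [h2h ch2 h2s]] := skeleton_step (j := j) cK uK ga _ ch1 h1s.
  by have [? H] := Hb1 x; split => //; exact: H.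
exists h2; split => // x sx; rewrite h2h ?h1h//; exact: skelS sx.
Qed.

End Skeleton.

(** * Lebesgue numbers and tracking radii *)

Section Approximation.
Context {R : realType}.

(** A Lebesgue number for an open cover of a compact set, measured by the mesh
    of a grid. *)
Lemma lebesgue_mesh d (C : set 'rV[R]_d) (Y : topologicalType) (I : Type)
    (g : 'rV[R]_d -> Y) (S : set I) (O : I -> set Y) :
  compact C -> {within C, continuous g} -> (forall i, open (O i)) ->
  (forall x, C x -> exists2 i, S i & O i (g x)) ->
  exists N : nat, forall x, C x -> exists2 i, S i &
    forall y, C y -> `|x - y| <= 2 / N.+1%:R -> O i (g y).
Proof.
move=> /compact_near_coveringP cC cg oO cov.
have /cC : forall x, C x -> \forall x' \near x & N \near \oo,
    exists2 i, S i & forall y, C y -> `|x' - y| <= 2 / N.+1%:R -> O i (g y).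
  move=> x Cx; have [i Si Oi] := cov x Cx.
  have : \forall y \near x, C y -> O i (g y).
    have /subspace_continuousP/(_ x Cx) := cg.
    by apply; apply: open_nbhs_nbhs; split.
  move=> /nbhs_ballP[e /= e0 He].
  exists (ball x (e / 2), [set N : nat | 2 / N.+1%:R < e / 2]).
    split; first by apply: nbhsx_ballx; rewrite divr_gt0.
    near=> N; rewrite /= ltr_pdivrMr ?ltr0n// mulrC -ltr_pdivrMr ?divr_gt0//.
    apply: (@lt_trans _ _ N%:R); last by rewrite ltr_nat.
    by near: N; exact: nbhs_infty_gtr.
  move=> [x' N] [/= bx' HN]; exists i => // y Cy xy; apply: He => //.
  rewrite -ball_normE /= in bx' *.
  have := ler_normD (x - x') (x' - y); rewrite addrA subrK.
  move: HN xy bx'; rewrite /=; move: (2 / N.+1%:R) => t t1 t2 t3 t4.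
  by lra.
move=> [N _ HN]; exists N => x Cx.
exact: (HN N (leqnn N) x Cx).
Unshelve. all: by end_near. Qed.

(** Points of [M] whose images in [Y] have intersecting balls of radii [r] are
    close on the scale of [b]. *)
Lemma tracking_radius (M Y : metricType R) (e : M -> Y) (b : M -> R) :
  (forall x eps, 0 < eps -> exists2 del, 0 < del &
    forall y, mdist (e x) (e y) < del -> mdist x y < eps) ->
  gauge b ->
  exists2 r : M -> R, forall m, 0 < r m & forall m m',
    mdist (e m) (e m') < r m + r m' ->
    mdist m m' < b m / 8 /\ mdist m m' < b m' / 8.
Proof.
move=> emb [b0 bL].
have /choice[del Hdel] : forall m, exists del, 0 < del /\
    forall y, mdist (e m) (e y) < del -> mdist m y < b m / 16.
  move=> m; have [|del del0 H] := emb m (b m / 16); first by rewrite divr_gt0.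
  by exists del.
exists (fun m => del m / 2) => [m|m m']; first by rewrite divr_gt0//; have [] := Hdel m.
have [d0 Hd] := Hdel m; have [d0' Hd'] := Hdel m'.
have L := bL m m'; have := bL m' m; rewrite (metric_sym m' m) => L' H.
have bm := b0 m; have bm' := b0 m'.
have [le|lt] := leP (del m') (del m).
  by have : mdist m m' < b m / 16; [apply: Hd|]; lra.
have : mdist m' m < b m' / 16; first by apply: Hd'; rewrite metric_sym; lra.
by rewrite metric_sym; lra.
Qed.

End Approximation.

(** * Moving a filling near a closed set into that set, up to its skeleton *)

Section Refinement.
Context {R : realType}.

(** Asking that [O] contain [U], rather than that it be an extension of [U],
    makes the condition monotone; intersecting [O] with an open extension of [U]
    reduces it to the case of extensions. *)
Lemma WLC_pullback n (M Y : metricType R) (e : M -> Y) :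
  closed_embedding e -> WLC_in R n (range e) ->
  forall (x : M) (U : set M), open U -> U x -> exists2 V : set M, nbhs x V &
    forall O : set Y, open O -> e @` U `<=` O -> forall d, (0 < d <= n.+1)%N ->
    forall h : 'rV[R]_d -> M, {within cube_bd d, continuous h} ->
    (forall x, cube_bd d x -> V (h x)) -> fillable O (fun x => e (h x)).
Proof.
move=> [ce ie cle oe] [_ wlc] x U oU Ux.
have [Ue oUe UeE] := oe U oU.
have [V' [V'e [W [W1 oW1 W1E] [Wx WV]]] HV] :=
  wlc (e x) (e @` U) (imageT e x) (oe U oU) (imageP e Ux).
exists (e @^-1` W1).
  apply: ce; apply: open_nbhs_nbhs; split => //.
  by move: Wx; rewrite -W1E => -[].
move=> O oO UO [//|k]; rewrite ltnS => /andP[_ kn] h ch hV.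
have [g [cg gU gh]] : fillable (O `&` Ue) (fun x => e (h x)).
  apply: null_homotopic_fillable; apply: HV kn _ _.
    split; first exact: openI.
    rewrite -setIA UeE; apply/seteqP; split => [y []//|y Uy]; split => //.
    exact: UO.
  split.
    apply: (within_comp (B := setT) (f := fun x => h (to_cube_bd x))) => //.
      exact: within_to_cube_bd.
    exact: within_continuous.
  move=> _ [y /sphere_neq0/to_cube_bd_in/hV Vy <-]; apply: WV.
  by rewrite -W1E; split => //; exists (h (to_cube_bd y)).
by exists g; split => // y /gU[].
Qed.

(** Weak local connectedness in [Y], made uniform by a gauge: boundaries of
    size [a] in [M] can be filled in any neighborhood in [Y] of the ball of
    radius [eps] in [M]. *)
Definition weakly_fills (M Y : metricType R) (e : M -> Y) d (a : M -> R) eps :=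
  forall x (O : set Y), open O -> e @` mball x eps `<=` O ->
  forall h : 'rV[R]_d -> M, {within cube_bd d, continuous h} ->
  (forall u, cube_bd d u -> mball x (a x) (h u)) -> fillable O (fun u => e (h u)).

Lemma gauge_weakly_fills (M Y : metricType R) (e : M -> Y) d eps :
  (forall (x : M) (U : set M), open U -> U x -> exists2 V : set M, nbhs x V &
    forall O : set Y, open O -> e @` U `<=` O ->
    forall h : 'rV[R]_d -> M, {within cube_bd d, continuous h} ->
    (forall x, cube_bd d x -> V (h x)) -> fillable O (fun x => e (h x))) ->
  0 < eps ->
  exists a : M -> R, [/\ gauge a, forall x, a x <= eps & weakly_fills e d a eps].
Proof.
move=> wlc eps0.
have [||a ga Ha] := @gauge_inf R M (fun x r => r <= eps /\
  forall (O : set Y), open O -> e @` mball x eps `<=` O ->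
  forall h : 'rV[R]_d -> M, {within cube_bd d, continuous h} ->
  (forall u, cube_bd d u -> mball x r (h u)) -> fillable O (fun u => e (h u))).
- move=> x r s sr [re H]; split=> [|O oO sO h ch hs]; first exact: le_trans sr re.
  by apply: H => // u /hs; rewrite /mball/= => /lt_le_trans; apply.
- move=> x.
  have Ux : mball x (eps / 2) x by rewrite /mball/= mdistxx; lra.
  have [V /nbhs_mballP[r r0 rV] HV] := wlc x _ (@open_mball _ _ x _) Ux.
  exists (Num.min (r / 2) (eps / 2)) => [|y].
    by rewrite lt_min; apply/andP; split; lra.
  rewrite lt_min => /andP[xy1 xy2]; split=> [|O oO sO h ch hs].
    by rewrite ge_min; apply/orP; right; lra.
  apply: HV => // [_ [z xz <-]|u ub].
    apply: sO; exists z => //; move: xz; rewrite /mball/= => xz.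
    by have := metric_triangle y x z; rewrite (metric_sym y x); lra.
  have := hs u ub; rewrite /mball/= lt_min => /andP[yz _]; apply: rV.
  by rewrite /mball/=; have := metric_triangle x y (h u); lra.
exists a; split => //; first by move=> x; have [] := Ha x.
by move=> x; have [_] := Ha x.
Qed.

(** Fill [h] in a neighborhood of the ball of radius [eps] so thin that every
    point of it is tracked by a point of [M].  On a grid that is fine for this
    filling, send the vertices to their tracking points and keep [h] on the
    boundary; vertices of one cell have nearby tracking points, so the
    assignment extends to the [n]-skeleton. *)
Lemma refine_boundary n (M Y : metricType R) (e : M -> Y) (a a' : M -> R) eps :
  (forall x eps, 0 < eps -> exists2 del, 0 < del &
    forall y, mdist (e x) (e y) < del -> mdist x y < eps) ->
  continuous e ->
  LC_cube n M -> gauge a -> (forall x, a x <= eps) -> weakly_fills e n.+1 a eps ->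
  gauge a' -> forall (h : 'rV[R]_n.+1 -> M) u0, cube_bd n.+1 u0 ->
  {within cube_bd n.+1, continuous h} -> small a h (cube_bd n.+1) ->
  exists N (h' : 'rV[R]_n.+1 -> M),
    let S := skel N (cube_bd n.+1) (cube n.+1) n in
    [/\ forall u, cube_bd n.+1 u -> h' u = h u,
      {within S, continuous h'},
      forall c : cell n.+1 N, small a' h' (ccell c `&` S) &
      forall v, S v -> exists2 w, mdist (h u0) w < eps & mdist w (h' v) < a' w].
Proof.
move=> emb ce lc ga aeps wf ga' h u0 u0b ch hs.
have [b [gb ba Hb]] := skeleton_extension lc ga'.
have [r r0 Hr] := tracking_radius emb gb.
pose Om m := mball (e m) (r m).
pose O := \bigcup_(m in mball (h u0) eps) Om m.
have eps0 : 0 < eps by apply: lt_le_trans (aeps (h u0)); exact: ga.1.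
(* [g] fills [h] within the union of the tracking balls *)
have [||u ub|g [cg gO gh]] := wf (h u0) O _ _ h ch.
- by apply: bigcup_open => m _; exact: open_mball.
- by move=> _ [m xm <-]; exists m => //; rewrite /Om/mball/= mdistxx.
- by have := hs u0 u u0b ub.
have [|x xc|N HN] := lebesgue_mesh (g := g) (S := mball (h u0) eps) (O := Om)
  (@compact_cube R n.+1) cg.
- by move=> m; exact: open_mball.
- by have [m] := gO x xc; exists m.
have /choice[m Hm] : forall x, exists m, cube n.+1 x -> mball (h u0) eps m /\
    forall y, cube n.+1 y -> `|x - y| <= 2 / N.+1%:R -> Om m (g y).
  move=> x; have [xc|] := pselect (cube n.+1 x); last by exists (h u0).
  by have [m um H] := HN x xc; exists m.
pose h0 x := if `|x| == 1 then h x else m x.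
have h0h x : cube_bd n.+1 x -> h0 x = h x by rewrite /h0 => ->; rewrite eqxx.
have h0m x : cube n.+1 x -> mdist (m x) (h0 x) < b (m x) / 8.
  move=> xc; have [_ H] := Hm x xc.
  have {H} : Om (m x) (g x) by apply: H => //; rewrite subrr normr0 divr_ge0.
  rewrite /h0; case: eqP => [xb|_ _]; last by rewrite mdistxx divr_gt0//; exact: gb.1.
  rewrite gh// => H; have [] // := Hr (m x) (h x).
  by apply: lt_le_trans H _; rewrite lerDl ltW.
have mm x y : cube n.+1 x -> cube n.+1 y -> `|x - y| <= 2 / N.+1%:R ->
    mdist (m x) (m y) < b (m x) / 8.
  move=> xc yc xy; have [_ Hx] := Hm x xc; have [_ Hy] := Hm y yc.
  have {}Hx := Hx y yc xy.
  have {}Hy : Om (m y) (g y) by apply: Hy => //; rewrite subrr normr0 divr_ge0.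
  have [] // := Hr (m x) (m y); rewrite /Om/mball/= in Hx Hy.
  have := metric_triangle (e (m x)) (g y) (e (m y)).
  by rewrite (metric_sym (g y) (e (m y))); lra.
have clK := @closed_cube_bd R n.+1.
have sub0 (x : 'rV[R]_n.+1) :
    skel N (cube_bd n.+1) (cube n.+1) 0 x -> cube n.+1 x.
  by move=> [xb|[c [_ cX cx]]]; [exact: cube_bd_sub|exact: cX].
have [||c _|h1 [h1h ch1 h1s]] := Hb n.+1 N (cube_bd n.+1) (cube n.+1) h0 clK.
- by move=> c x; exact: ocell_cube_bd.
- by apply: skel0_continuous => //; apply: within_eq ch => x xb; rewrite h0h.
- move=> p q [cp sp] [cq sq]; have pc := sub0 _ sp; have qc := sub0 _ sq.
  have pq := mm p q pc qc (ccell_mesh cp cq).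
  have Hp := h0m p pc; have Hq := h0m q qc.
  have L1 := gb.2 (m q) (m p); have L2 := gb.2 (m p) (h0 p).
  have T1 := metric_triangle (h0 p) (m p) (h0 q).
  have T2 := metric_triangle (m p) (m q) (h0 q).
  rewrite (metric_sym (m q) (m p)) in L1; rewrite (metric_sym (h0 p) (m p)) in T1.
  by have := gb.1 (m p); lra.
have h1u u : cube_bd n.+1 u -> h1 u = h u.
  by move=> ub; rewrite h1h ?h0h//; left.
exists N, h1; split => // [c|v [vb|[c [cn cX cv]]]].
- by apply: h1s; exact: ccell_cube.
- by exists (h v); rewrite ?h1u ?mdistxx//; [exact: lt_le_trans (hs u0 v u0b vb) _|exact: ga'.1].
have [v0 [x [v0dim v0x v0c]]] := @vertex_exists R _ _ c.
have s0x : skel N (cube_bd n.+1) (cube n.+1) 0 x.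
  by right; exists v0; split => //; [rewrite v0dim|exact: ccell_cube].
exists (h1 x).
  rewrite h1h// /h0; case: eqP => [xb|_]; first exact: lt_le_trans (hs u0 x u0b xb) _.
  by have [] := Hm x (sub0 _ s0x).
apply: (h1s c cX); split => //; [exact: v0c|exact: skelS s0x|].
by right; exists c.
Qed.

End Refinement.

(** * Iterated refinement in a complete space *)

Section Iteration.
Context {R : realType}.

Lemma exists_half_pow_lt (C e : R) : 0 < e -> exists i : nat, C / 2 ^+ i < e.
Proof.
move=> e0; exists (Num.truncn (C / e)).+1; set k := (Num.truncn (C / e)).+1.
rewrite ltr_pdivrMr ?exprn_gt0// mulrC -ltr_pdivrMr//.
apply: (@lt_trans _ _ k%:R); first exact: truncnS_gt.
by rewrite -natrX ltr_nat; exact: ltn_expl.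
Qed.

Lemma half_powS (C : R) i : C / 2 ^+ i.+1 = C / 2 ^+ i / 2.
Proof. by rewrite exprSr invfM mulrA. Qed.

Lemma half_pow_gt0 (C : R) i : 0 < C -> 0 < C / 2 ^+ i.
Proof. by move=> C0; rewrite divr_gt0// exprn_gt0. Qed.

Lemma complete_geometric_limit (M : metricType R) (u : nat -> M) (C : R) :
  complete_metric M -> (forall j, mdist (u j) (u j.+1) <= C / 2 ^+ j) ->
  exists l, forall j, mdist (u j) l <= 2 * (C / 2 ^+ j).
Proof.
move=> cM uC.
have C0 : 0 <= C by have := uC 0%N; rewrite expr0 divr1; apply: le_trans (mdist_ge0 _ _).
have pow_ge0 i : 0 <= C / 2 ^+ i by rewrite divr_ge0// exprn_ge0.
have uik i k : mdist (u i) (u (i + k)%N) <= 2 * (C / 2 ^+ i) - 2 * (C / 2 ^+ (i + k)).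
  elim: k => [|k IH]; first by rewrite addn0 mdistxx subrr.
  rewrite addnS half_powS; have := uC (i + k)%N.
  by have := metric_triangle (u i) (u (i + k)%N) (u (i + k).+1); lra.
have [|l ul] := cM (u @ \oo) _.
  apply: cauchy_exP => e e0; have [i Hi] := exists_half_pow_lt (2 * C) e0.
  exists (u i); exists i => // j /= ij; rewrite -mballE /mball/=.
  have := uik i (j - i)%N; rewrite subnKC// => H.
  by have := pow_ge0 j; move: Hi H; rewrite -mulrA; lra.
exists l => j; apply/ler_addgt0Pl => e e0.
have /ul[k _ Hk] : nbhs l (mball l e) by apply/nbhs_mballP; exists e.
have lk := Hk (j + k)%N (leq_addl _ _); rewrite /mball/= in lk.
have := uik j k; have := pow_ge0 (j + k)%N.
have := metric_triangle (u j) (u (j + k)%N) l.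
by rewrite (metric_sym (u (j + k)%N) l); lra.
Qed.

Lemma cdim_top d N (c : cell d N) : (forall i, odd (c i)) -> cdim c = d.
Proof.
move=> oc; rewrite -[RHS]card_ord -cardsT; apply: eq_card => i.
by rewrite !inE oc.
Qed.

Section Refinements.
Variables (n : nat) (M : metricType R) (A : nat -> M -> R) (eps : R).
Hypothesis eps_gt0 : 0 < eps.
Hypothesis A_le : forall i x, A i x <= eps / 2 ^+ i.

Local Notation V := 'rV[R]_n.+1.
Local Notation bd := (@cube_bd R n.+1).
Local Notation b0 := (const_mx 1 : V).

(** The sizes [A i] decrease geometrically; a boundary of stage [i] is one of
    size [A i]. *)
Definition boundary_ok (i : nat) (h : V -> M) :=
  {within bd, continuous h} /\ small (A i) h bd.

(** [q] consists of a grid and of a map on its [n]-skeleton that extends the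
    stage [p.1] boundary [p.2] and restricts to boundaries of the next stage on
    all subcubes. *)
Definition refines (p : nat * (V -> M)) (q : nat * (V -> M)) :=
  let S : set V := skel q.1 bd (cube n.+1) n in
  [/\ forall u, bd u -> q.2 u = p.2 u, {within S, continuous q.2},
    forall c : cell n.+1 q.1, small (A p.1.+1) q.2 (ccell c `&` S) &
    forall v, S v -> exists2 w, mdist (p.2 b0) w < eps / 2 ^+ p.1 &
      mdist w (q.2 v) < A p.1.+1 w].

Variable F : nat * (V -> M) -> nat * (V -> M).
Hypothesis F_refines : forall p, boundary_ok p.1 p.2 -> refines p (F p).

Definition top_cell N (x : V) : cell n.+1 N :=
  odflt [ffun=> ord0] [pick c : cell n.+1 N | `[< (forall i, odd (c i)) /\ ccell c x >]].

Lemma top_cellP N x : cube n.+1 x ->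
  (forall i, odd (top_cell N x i)) /\ ccell (top_cell N x) x.
Proof.
move=> /(@top_exists _ _ N)[c oc cx]; rewrite /top_cell.
by case: pickP => [c' /asboolP//|/(_ c)/asboolP[]].
Qed.

Definition on_cell N (c : cell n.+1 N) (h : V -> M) : V -> M :=
  fun u => h (cell_param c id u).

(** The [j]-th approximation of a filling of a boundary [h] of stage [i].  It is
    computed from outside in: locate a subcube containing [x], rescale it to the
    standard cube and continue with its boundary.  It is discontinuous, and on
    the innermost cubes it is constant off the boundary. *)
Fixpoint approx (j i : nat) (h : V -> M) (x : V) : M :=
  if j is j'.+1 then
    let q := F (i, h) in let c := top_cell q.1 x in
    approx j' i.+1 (on_cell c q.2) (cell_chart c id x)
  else if `|x| == 1 then h x else h b0.

Section OneRefinement.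
Variables (i : nat) (h : V -> M).
Hypothesis h_ok : boundary_ok i h.
Let q := F (i, h).
Let S : set V := skel q.1 bd (cube n.+1) n.

Lemma top_odd N (c : cell n.+1 N) : (forall k, odd (c k)) ->
  forall k, odd (c k) <-> exists a, id a = k.
Proof. by move=> oc k; split => // _; exists k. Qed.

Lemma top_bd_skel (c : cell n.+1 q.1) x : (forall k, odd (c k)) ->
  ccell c x -> ~ ocell c x -> S x.
Proof.
by move=> /cdim_top cn cx nox; apply: skel_face cn cx nox; exact: ccell_cube.
Qed.

Lemma param_skel (c : cell n.+1 q.1) u : (forall k, odd (c k)) ->
  bd u -> (ccell c `&` S) (cell_param c id u).
Proof.
move=> oc ub; have cu : ccell c (cell_param c id u).
  by apply: (cell_paramP (top_odd oc)); exact: cube_bd_sub.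
split => //; apply: (top_bd_skel oc cu).
exact: (cell_param_bd (@inj_id _) (top_odd oc)).
Qed.

Lemma on_cell_ok (c : cell n.+1 q.1) : (forall k, odd (c k)) ->
  boundary_ok i.+1 (on_cell c q.2).
Proof.
move=> oc; have [_ ch' hs _] := F_refines (p := (i, h)) h_ok; split.
  apply: within_comp ch' => [u ub|]; first by have [] := param_skel oc ub.
  by apply: within_continuous; exact: cell_param_continuous.
by move=> u v ub vb; apply: (hs c); exact: param_skel.
Qed.

Lemma on_cell_bd (c : cell n.+1 q.1) x : (forall k, odd (c k)) ->
  ccell c x -> ~ ocell c x ->
  bd (cell_chart c id x) /\ on_cell c q.2 (cell_chart c id x) = q.2 x.
Proof.
move=> oc cx nox; split; first exact: (cell_chart_bd (top_odd oc)).
by rewrite /on_cell (cell_chartK (top_odd oc)).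
Qed.

Lemma top_not_ocell (c : cell n.+1 q.1) x : (forall k, odd (c k)) -> bd x ->
  ~ ocell c x.
Proof. by move=> /cdim_top cn xb /ocell_cube_bd_dim/(_ xb); rewrite cn ltnn. Qed.

End OneRefinement.

Lemma approx_bd j i h x : boundary_ok i h -> bd x -> approx j i h x = h x.
Proof.
elim: j i h x => [|j IH] i h x h_ok xb /=; first by rewrite xb eqxx.
have [oc cx] := top_cellP (F (i, h)).1 (cube_bd_sub xb).
have [cb cE] := on_cell_bd oc cx (top_not_ocell oc xb).
rewrite IH ?cE//; last exact: on_cell_ok.
by have [-> //] := F_refines (p := (i, h)) h_ok.
Qed.

(** The choice of a subcube does not matter: on a common frontier both choices
    give the value already fixed on the skeleton. *)
Lemma approx_cell j i h x (c : cell n.+1 (F (i, h)).1) :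
  boundary_ok i h -> (forall k, odd (c k)) -> ccell c x ->
  approx j.+1 i h x = approx j i.+1 (on_cell c (F (i, h)).2) (cell_chart c id x).
Proof.
move=> h_ok oc cx /=.
have [oc' cx'] := top_cellP (F (i, h)).1 (ccell_cube cx).
set c' := top_cell _ _ in oc' cx' *.
have [ox|nox] := pselect (ocell c' x).
  by rewrite (ocell_uniq ox cx)// !cdim_top.
have nox2 : ~ ocell c x.
  by move=> ox; apply: nox; rewrite (ocell_uniq ox cx')// !cdim_top.
have [cb cE] := on_cell_bd oc cx nox2; have [cb' cE'] := on_cell_bd oc' cx' nox.
by rewrite !approx_bd ?cE ?cE'//; exact: on_cell_ok.
Qed.

Lemma approx_near j i h x : boundary_ok i h -> cube n.+1 x ->
  mdist (h b0) (approx j i h x) <= 4 * (eps / 2 ^+ i).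
Proof.
elim: j i h x => [|j IH] i h x h_ok xc /=; have e0 := half_pow_gt0 i eps_gt0.
  case: eqP => [xb|_]; last by rewrite mdistxx; lra.
  have := h_ok.2 b0 x (cube_bd_const1 n) xb; have := A_le i (h b0); lra.
have [oc cx] := top_cellP (F (i, h)).1 xc.
have := IH i.+1 _ (cell_chart (top_cell (F (i, h)).1 x) id x) (on_cell_ok h_ok oc)
  (cell_chartP _ cx).
have [_ _ _ near] := F_refines (p := (i, h)) h_ok.
have [_ /near[w /= hw]] := param_skel oc (cube_bd_const1 n).
have := A_le i.+1 w; rewrite half_powS.
set y := approx _ _ _ _; rewrite /on_cell; set z := (F _).2 _ => Aw wz zy.
have := metric_triangle (h b0) w y; have := metric_triangle w z y.
by move: (eps / 2 ^+ i) e0 hw Aw wz zy => t; lra.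
Qed.

Lemma approx_succ j i h x : boundary_ok i h -> cube n.+1 x ->
  mdist (approx j i h x) (approx j.+1 i h x) <= 8 * (eps / 2 ^+ (i + j)).
Proof.
elim: j i h x => [|j IH] i h x h_ok xc.
  have := approx_near 0 h_ok xc; have := approx_near 1 h_ok xc; rewrite addn0.
  have := metric_triangle (approx 0 i h x) (h b0) (approx 1 i h x).
  by rewrite (metric_sym (approx 0 i h x) (h b0)); lra.
have [oc cx] := top_cellP (F (i, h)).1 xc.
rewrite !(approx_cell _ h_ok oc cx) -addSnnS.
by apply: IH; [exact: on_cell_ok|exact: cell_chartP].
Qed.

(** Near [x] only the subcubes through [x] matter, and each of them is governed
    by the next stage. *)
Lemma approx_osc j i h x : boundary_ok i h -> cube n.+1 x ->
  osc_le (cube n.+1) (approx j i h) x (eps / 2 ^+ (i + j)).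
Proof.
elim: j i h x => [|j IH] i h x h_ok xc.
  apply: filterE => y yc; rewrite addn0 /=; have b0b := cube_bd_const1 n.
  have [x1 [x1b ->]] : exists x1, bd x1 /\ (if `|x| == 1 then h x else h b0) = h x1.
    by case: eqP => [xb|_]; [exists x|exists b0].
  have [y1 [y1b ->]] : exists y1, bd y1 /\ (if `|y| == 1 then h y else h b0) = h y1.
    by case: eqP => [yb|_]; [exists y|exists b0].
  by have := h_ok.2 x1 y1 x1b y1b; have := A_le i (h x1); lra.
pose G (c : cell n.+1 (F (i, h)).1) : set V := if `[< forall k, odd (c k) >] then ccell c else set0.
apply: (osc_le_paste (F := G)) => [c|y yc|c].
- by rewrite /G; case: ifP => _; [exact: closed_ccell|exact: closed0].
- have [oc cy] := top_cellP (F (i, h)).1 yc.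
  by exists (top_cell (F (i, h)).1 y); rewrite /G asboolT.
rewrite /G; case: asboolP => // oc cx.
have := IH i.+1 _ (cell_chart c id x) (on_cell_ok h_ok oc) (cell_chartP _ cx).
have cc := @cell_chart_continuous R _ _ c _ id x.
rewrite addSnnS => Hc.
have {}Hc : nbhs x (cell_chart c id @^-1` _) := cc _ Hc.
apply: filterS Hc => y H [yc cy].
rewrite !(approx_cell _ h_ok oc) //; exact: (H (cell_chartP _ cy)).
Qed.

(** A uniform limit of maps whose oscillation tends to zero is continuous. *)
Lemma approx_limit h : complete_metric M -> boundary_ok 0 h ->
  exists g : V -> M, [/\ {within cube n.+1, continuous g},
    forall x, bd x -> g x = h x &
    forall x, cube n.+1 x -> mdist (h b0) (g x) <= 4 * eps].
Proof.
move=> cM h_ok.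
have /choice[g Hg] : forall x, exists l, cube n.+1 x -> forall j,
    mdist (approx j 0 h x) l <= 16 * (eps / 2 ^+ j).
  move=> x; have [xc|] := pselect (cube n.+1 x); last by exists (h b0).
  have [j|l Hl] := complete_geometric_limit (u := fun j => approx j 0 h x)
    (C := 8 * eps) cM.
    by have := approx_succ j h_ok xc; rewrite mulrA.
  by exists l => _ j; have := Hl j; rewrite -mulrA; lra.
(* two errors of 16 for the limit and 1 for the oscillation *)
have small_eps e : 0 < e -> exists j : nat, 33 * (eps / 2 ^+ j) < e.
  by move=> /(exists_half_pow_lt (33 * eps))[j]; rewrite -mulrA; exists j.
exists g; split.
- apply/within_oscP => x xc e e0; have [j Hj] := small_eps e e0.
  apply: filterS (approx_osc j h_ok xc) => y H yc.
  have := H yc; have := Hg x xc j; have := Hg y yc j.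
  have := metric_triangle (g x) (approx j 0 h x) (g y).
  have := metric_triangle (approx j 0 h x) (approx j 0 h y) (g y).
  by rewrite (metric_sym (g x) (approx j 0 h x)) add0n; lra.
- move=> x xb; apply/esym/mdist_positivity/eqP; rewrite eq_le mdist_ge0 andbT.
  apply/ler_addgt0Pl => e e0; have [j Hj] := small_eps e e0.
  have := Hg x (cube_bd_sub xb) j; rewrite approx_bd//.
  by have := half_pow_gt0 j eps_gt0; lra.
- move=> x xc; apply/ler_addgt0Pl => e e0; have [j Hj] := small_eps e e0.
  have := Hg x xc j; have := approx_near j h_ok xc; rewrite expr0 divr1.
  have := metric_triangle (h b0) (approx j 0 h x) (g x).
  by have := half_pow_gt0 j eps_gt0; lra.
Qed.

End Refinements.

End Iteration.

(** * Weak local connectedness implies local connectedness *)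

Section WLCtoLC.
Context {R : realType}.

Lemma closed_embedding_inv (M Y : metricType R) (e : M -> Y) :
  closed_embedding e -> forall x eps, 0 < eps -> exists2 del, 0 < del &
    forall y, mdist (e x) (e y) < del -> mdist x y < eps.
Proof.
move=> [_ ie _ oe] x eps e0; have [W oW WE] := oe _ (@open_mball _ _ x eps).
have Wx : W (e x).
  suff : (W `&` range e) (e x) by case.
  by rewrite WE; exists x => //; rewrite /mball/= mdistxx.
have /nbhs_mballP[del del0 sub] : nbhs (e x) W by apply: open_nbhs_nbhs.
exists del => // y /sub Wy.
have : (W `&` range e) (e y) by split => //; exists y.
by rewrite WE => -[z xz /ie <-].
Qed.

(** Lower-dimensional cubes are filled by hypothesis.  A small boundary of
    dimension [n] is filled by iterating [refine_boundary]. *)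
Lemma LC_cube_succ n (M Y : metricType R) (e : M -> Y) :
  complete_metric M -> closed_embedding e -> LC_cube n M ->
  (forall eps, 0 < eps -> exists a : M -> R,
    [/\ gauge a, forall x, a x <= eps & weakly_fills e n.+1 a eps]) ->
  LC_cube n.+1 M.
Proof.
move=> cM emb lc wf x U oU Ux.
have [V0 V0x HV0] := lc x U oU Ux.
have /nbhs_mballP[r r0 rU] : nbhs x U by apply: open_nbhs_nbhs.
(* the filling stays within [4 * eps] of [h], and [h] within [eps] of [x] *)
pose eps := r / 8; have eps0 : 0 < eps by rewrite divr_gt0.
have /choice[A HA] : forall i : nat, exists a : M -> R, [/\ gauge a,
    forall x, a x <= eps / 2 ^+ i & weakly_fills e n.+1 a (eps / 2 ^+ i)].
  by move=> i; apply: wf; exact: half_pow_gt0.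
have Ale i y : A i y <= eps / 2 ^+ i by have [_ ->] := HA i.
have /choice[F HF] : forall p : nat * ('rV[R]_n.+1 -> M),
    exists q : nat * ('rV[R]_n.+1 -> M),
    boundary_ok A p.1 p.2 -> refines A eps p q.
  move=> [i h]; have [[ch hs]|] := pselect (boundary_ok A i h); last by exists (0%N, h).
  have [gA Ai wfi] := HA i; have [gA' _ _] := HA i.+1.
  have [N [h' H]] := refine_boundary (closed_embedding_inv emb)
    (let: And4 ce _ _ _ := emb in ce) lc gA Ai wfi gA' (cube_bd_const1 n) ch hs.
  by exists (N, h').
have [[A0 AL] _ _] := HA 0%N.
exists (V0 `&` mball x (A 0%N x / 4)).
  apply: filterI => //; apply/nbhs_mballP; exists (A 0%N x / 4) => //.
  by rewrite divr_gt0.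
move=> d /andP[d0]; rewrite leq_eqVlt ltnS => /orP[/eqP ->|dn]; last first.
  by apply: fillsS (HV0 d _) => [y []//|//|]; rewrite d0.
move=> h ch hV.
have hx u : cube_bd n.+1 u -> mdist x (h u) < A 0%N x / 4 by move=> /hV[].
have h_ok : boundary_ok A 0 h.
  split=> // p q /hx hp /hx hq; have := AL x (h p).
  have := metric_triangle (h p) x (h q); rewrite (metric_sym (h p) x).
  by have := A0 x; lra.
have [g [cg gh gn]] := approx_limit eps0 Ale HF cM h_ok.
exists g; split => // u uc; apply: rU; rewrite /mball/=.
have := gn u uc; have := hx _ (cube_bd_const1 n); have := Ale 0%N x.
have := metric_triangle x (h (const_mx 1)) (g u).
by rewrite expr0 divr1 /eps; move: eps0; rewrite /eps; lra.
Qed.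

Lemma WLC_LC n (M : metricType R) : complete_metric M -> WLC n M -> LC R n M.
Proof.
move=> cM [Y [e [_ emb wlc]]]; apply/LC_cubeP.
have wp := WLC_pullback emb wlc.
have : (n.+1 <= n.+1)%N by []; move: {-2}n.+1 => m.
elim: m => [|m IH] mn.
  by move=> x U _ _; exists setT; [exact: filterT|case].
apply: (LC_cube_succ cM emb (IH (ltnW mn))) => eps eps0.
apply: gauge_weakly_fills eps0 => x U oU Ux.
have [V Vx HV] := wp x U oU Ux; exists V => // O oO UO h ch hV.
exact: HV.
Qed.

Lemma ALC_WLC n (M : metricType R) : ALC n M -> WLC n M.
Proof.
move=> [Y [e [aY emb [cl alc]]]]; exists Y, e; split => //; split => // x U Ax oU Ux.
have [V Vx HV] := alc x U Ax oU Ux; exists V => // Ue UeU.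
have [Ve [_ VeV] H] := HV Ue UeU; move=> k kn f [cf fV]; apply: H kn _ _.
by split => // y /fV Vy; move: Vy; rewrite -VeV => -[].
Qed.

End WLCtoLC.

(** * The space of functions into the unit interval *)

(** The functions on [T] with values in the unit interval.  When [T] is a metric
    space, they contain it with its truncated metric; they form a convex space,
    and an ANR for elementary reasons.  This makes them a substitute for a normed
    space, where Dugundji's extension theorem would be called for. *)
Record unit_fun (R : realType) (T : Type) := UnitFun {
  unit_val :> T -> R;
  unit_bound : forall t, 0 <= unit_val t <= 1 }.

HB.instance Definition _ (R : realType) (T : Type) := gen_eqMixin (unit_fun R T).
HB.instance Definition _ (R : realType) (T : Type) := gen_choiceMixin (unit_fun R T).

Section UnitFun.
Context {R : realType} {T : Type}.
Implicit Types f g h : unit_fun R T.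

Lemma unit_fun_eq f g : (forall t, f t = g t) -> f = g.
Proof.
case: f g => [f fb] [g gb] /= fg; have E : f = g by apply: funext.
by rewrite E in fb *; rewrite (Prop_irrelevance fb gb).
Qed.

Lemma unit_ge0 f t : 0 <= f t. Proof. by have /andP[] := unit_bound f t. Qed.
Lemma unit_le1 f t : f t <= 1. Proof. by have /andP[] := unit_bound f t. Qed.

(** For empty [T] the supremum of the empty set is 0, as it should be. *)
Definition udist f g : R := sup (range (fun t => `|f t - g t|)).

Lemma udist_le f g e : 0 <= e -> (forall t, `|f t - g t| <= e) -> udist f g <= e.
Proof.
move=> e0 H; have [S0|/nonemptyPn S0] := pselect (range (fun t => `|f t - g t|) !=set0).
  by apply: ge_sup => // _ [t _ <-].
by rewrite /udist S0 sup0.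
Qed.

Lemma udist_ge f g t : `|f t - g t| <= udist f g.
Proof.
apply: ub_le_sup; last by exists t.
exists 1 => _ [s _ <-]; rewrite ler_norml.
by have := unit_ge0 f s; have := unit_ge0 g s; have := unit_le1 f s;
  have := unit_le1 g s; move=> *; apply/andP; split; lra.
Qed.

Lemma udistxx f : udist f f = 0.
Proof.
apply/eqP; rewrite eq_le; apply/andP; split.
  by apply: udist_le => // t; rewrite subrr normr0.
have [[t _]|/nonemptyPn S0] := pselect ([set: T] !=set0).
  by apply: le_trans (udist_ge f f t).
by rewrite /udist S0 image_set0 sup0.
Qed.

Lemma udist_eq0 f g : udist f g = 0 -> f = g.
Proof.
move=> fg; apply: unit_fun_eq => t; apply/eqP; rewrite -subr_eq0 -normr_le0.
by rewrite -fg; exact: udist_ge.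
Qed.

Lemma udist_sym f g : udist f g = udist g f.
Proof. by rewrite /udist; congr sup; apply: eq_imagel => t _; rewrite distrC. Qed.

Lemma udist_triangle g f h : udist f h <= udist f g + udist g h.
Proof.
have [[t0 _]|/nonemptyPn S0] := pselect ([set: T] !=set0); last first.
  by rewrite /udist S0 !image_set0 !sup0 addr0.
apply: udist_le => [|t].
  by apply: addr_ge0; [apply: le_trans (udist_ge f g t0)|apply: le_trans (udist_ge g h t0)].
have := udist_ge f g t; have := udist_ge g h t.
by have := ler_normD (f t - g t) (g t - h t); rewrite addrA subrK; lra.
Qed.

HB.instance Definition _ := @isMetric.Build R (unit_fun R T)
  udist udistxx udist_eq0 udist_sym udist_triangle.

Lemma unit_mdist_le f g e : 0 <= e -> (forall t, `|f t - g t| <= e) -> mdist f g <= e.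
Proof. exact: udist_le. Qed.

Lemma unit_mdist_ge f g t : `|f t - g t| <= mdist f g.
Proof. exact: udist_ge. Qed.

End UnitFun.

Section UnitFunExtension.
Context {R : realType} {T : Type} (Z : metricType R).
Local Notation Y := (unit_fun R T).
Variable e : Y -> Z.
Hypothesis e_emb : closed_embedding e.

Let zero : Y := @UnitFun R T (fun=> 0) (fun=> introT andP (conj (lexx 0) ler01)).

Definition range_dist (z : Z) : R := inf (range (fun y => mdist z (e y))).

Lemma range_dist_le z y : range_dist z <= mdist z (e y).
Proof. by apply: ge_inf; [exists 0 => _ [? _ <-]; exact: mdist_ge0|exists y]. Qed.

Lemma range_dist_lt z r : range_dist z < r -> exists y, mdist z (e y) < r.
Proof.
by move=> /inf_lt[|_ [y _ <-] yr]; [exists (mdist z (e zero)), zero|exists y].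
Qed.

Lemma range_dist_lipschitz z z' : range_dist z <= range_dist z' + mdist z z'.
Proof.
rewrite -lerBlDr; apply: lb_le_inf; first by exists (mdist z' (e zero)), zero.
move=> _ [y _ <-]; have := range_dist_le z y.
by have := metric_triangle z z' (e y); lra.
Qed.

Lemma range_dist_gt0 z : ~ range e z -> 0 < range_dist z.
Proof.
move=> nz; have [_ _ cl _] := e_emb.
have /nbhs_mballP[r r0 sub] : nbhs z (~` range e).
  by apply: open_nbhs_nbhs; split => //; exact: closed_openC.
apply: lt_le_trans r0 _; apply: lb_le_inf; first by exists (mdist z (e zero)), zero.
by move=> _ [y _ <-]; rewrite leNgt; apply/negP => /sub; apply; exists y.
Qed.

(** Hausdorff's formula for the extension of the function [e y |-> y t] to the
    points [z] off the range of [e]. *)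
Definition hausdorff_ext (z : Z) (t : T) : R :=
  inf (range (fun y : Y => y t + mdist z (e y) / range_dist z - 1)).

Section Outside.
Variable z : Z.
Hypothesis nz : ~ range e z.
Let D0 := range_dist_gt0 nz.

Lemma ratio_ge1 y : 1 <= mdist z (e y) / range_dist z.
Proof. by rewrite ler_pdivlMr// mul1r range_dist_le. Qed.

Lemma hausdorff_ext_le t (y : Y) :
  hausdorff_ext z t <= y t + mdist z (e y) / range_dist z - 1.
Proof.
apply: ge_inf; last by exists y.
by exists 0 => _ [u _ <-]; have := ratio_ge1 u; have := unit_ge0 u t; lra.
Qed.

Lemma hausdorff_ext_lt t r : hausdorff_ext z t < r ->
  exists y : Y, y t + mdist z (e y) / range_dist z - 1 < r.
Proof.
move=> /inf_lt[|_ [y _ <-] yr]; last by exists y.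
by exists (zero t + mdist z (e zero) / range_dist z - 1), zero.
Qed.

Lemma hausdorff_ext_ge t r :
  (forall y : Y, r <= y t + mdist z (e y) / range_dist z - 1) ->
  r <= hausdorff_ext z t.
Proof.
move=> H; apply: lb_le_inf; last by move=> _ [y _ <-].
by exists (zero t + mdist z (e zero) / range_dist z - 1), zero.
Qed.

Lemma near_point eta : 0 < eta ->
  exists y, mdist z (e y) / range_dist z < 1 + eta.
Proof.
move=> eta0; have [|y Hy] := @range_dist_lt z ((1 + eta) * range_dist z).
  by rewrite ltr_pMl// ltrDl.
by exists y; rewrite ltr_pdivrMr.
Qed.

Lemma hausdorff_ext_bound t : 0 <= hausdorff_ext z t <= 1.
Proof.
apply/andP; split.
  by apply: hausdorff_ext_ge => y; have := ratio_ge1 y; have := unit_ge0 y t; lra.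
apply/ler_addgt0Pl => eta eta0; have [y Hy] := near_point eta0.
by have := hausdorff_ext_le t y; have := unit_le1 y t; lra.
Qed.

End Outside.

(** Only points [e y] whose distance to [z] is at most three times the distance
    from [z] to the range compete for the infimum, because the values of [y] lie
    between 0 and 1; over these points the quotient of distances is
    equi-Lipschitz near [z].  The bound does not depend on [t]. *)
Lemma hausdorff_ext_close z z' t r : ~ range e z -> ~ range e z' ->
  mdist z z' <= r ->
  hausdorff_ext z' t <= hausdorff_ext z t + 4 * (r / range_dist z').
Proof.
move=> nz nz' zr; have D0 := range_dist_gt0 nz; have D0' := range_dist_gt0 nz'.
have r0 : 0 <= r := le_trans (mdist_ge0 _ _) zr.
apply/ler_addgt0Pl => eta0 eta0_gt0; pose eta := Num.min eta0 1.
have eta_gt0 : 0 < eta by rewrite lt_min eta0_gt0 ltr01.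
have eta_le : eta <= eta0 by rewrite ge_min lexx.
have eta_le1 : eta <= 1 by rewrite ge_min lexx orbT.
have [|y Hy] := @hausdorff_ext_lt z t (hausdorff_ext z t + eta).
  by rewrite ltrDl.
have /andP[_ I1] := hausdorff_ext_bound nz t.
set phi := mdist z (e y) / range_dist z in Hy.
have phi3 : phi <= 3 by have := unit_ge0 y t; lra.
have phi0 : 1 <= phi := ratio_ge1 nz y.
apply: le_trans (hausdorff_ext_le nz' t y) _.
suff : mdist z' (e y) / range_dist z' <= phi + 4 * (r / range_dist z').
  have := unit_ge0 y t; lra.
have E : 4 * (r / range_dist z') * range_dist z' = 4 * r.
  by rewrite -mulrA divfK// gt_eqF.
rewrite ler_pdivrMr// mulrDl E.
have := metric_triangle z' z (e y); rewrite (metric_sym z' z).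
have phiE : mdist z (e y) = phi * range_dist z by rewrite /phi divfK ?gt_eqF.
have := range_dist_lipschitz z z'; rewrite phiE => L Tr.
have : phi * range_dist z <= phi * (range_dist z' + r).
  by rewrite ler_pM2l; lra.
have : phi * r <= 3 * r by rewrite ler_wpM2r.
by rewrite mulrDr; lra.
Qed.

(** Continuity at a point [e y0] of the range: for [z] close to [e y0], the points
    [e y] competing for the infimum are close to [e y0], so that [y] is
    uniformly close to [y0]. *)
Lemma unit_fun_extension : exists2 F : Z -> Y, continuous F & forall y, F (e y) = y.
Proof.
have [ce ie cl oe] := e_emb.
have /choice[F HF] : forall z, exists f : Y, (forall y, z = e y -> f = y) /\
    (~ range e z -> forall t, f t = hausdorff_ext z t).
  move=> z; have [[y _ yz]|nz] := pselect (range e z).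
    by exists y; split => [u|nz]; [rewrite -yz => /ie|exfalso; apply: nz; exists y].
  exists (UnitFun (hausdorff_ext_bound nz)); split => // y zy.
  by exfalso; apply: nz; exists y.
have Fe y : F (e y) = y by have [H _] := HF (e y); exact: H.
exists F => // z0.
apply/(@metricType_numDomainType.cvgrPdist_le _ _ _ (nbhs z0)) => eps eps0.
have [[y0 _ <-]|nz0] := pselect (range e z0).
  have [|del del0 Hdel] := closed_embedding_inv e_emb y0 (eps := eps / 2).
    by rewrite divr_gt0.
  (* points within twice the distance of [z] to the range are within [del] of [e y0] *)
  apply/nbhs_mballP; exists (del / 3); first by rewrite divr_gt0.
  move=> z; rewrite /mball/= => zd; rewrite Fe.
  have [[y _ yz]|nz] := pselect (range e z).
    rewrite -yz Fe ltW//; apply: lt_trans (Hdel y _) _; last by lra.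
    by rewrite yz; lra.
  have dz : range_dist z < del / 3.
    apply: le_lt_trans (range_dist_le z y0) _; by rewrite metric_sym.
  have close y t : mdist z (e y) < 2 * range_dist z -> `|y0 t - y t| < eps / 2.
    move=> zy; apply: le_lt_trans (unit_mdist_ge y0 y t) _; apply: Hdel.
    by have := metric_triangle (e y0) z (e y); lra.
  have D0 := range_dist_gt0 nz.
  apply: unit_mdist_le => [|t]; first exact: ltW.
  have [_ /(_ nz t)->] := HF z; rewrite ler_norml; apply/andP; split.
    pose kap := Num.min (eps / 2) 1.
    have kap0 : 0 < kap by rewrite lt_min ltr01 divr_gt0.
    have [y Hy] := near_point nz kap0.
    have k1 : kap <= eps / 2 by rewrite ge_min lexx.
    have k2 : kap <= 1 by rewrite ge_min lexx orbT.
    have /(close y t) : mdist z (e y) < 2 * range_dist z.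
      by rewrite -ltr_pdivrMr//; lra.
    rewrite ltr_norml => /andP[c1 c2].
    by have := hausdorff_ext_le nz t y; lra.
  rewrite lerBlDr -lerBlDl; apply: hausdorff_ext_ge => y.
  have [far|near] := leP 2 (mdist z (e y) / range_dist z).
    by have := unit_le1 y0 t; have := unit_ge0 y t; lra.
  have := ratio_ge1 nz y; have := close y t; rewrite -ltr_pdivrMr// => /(_ near).
  by rewrite ltr_norml => /andP[c1 c2]; lra.
have D0 := range_dist_gt0 nz0.
have out : nbhs z0 (~` range e).
  by apply: open_nbhs_nbhs; split => //; exact: closed_openC.
pose r := Num.min (range_dist z0 / 2) (eps * range_dist z0 / 8).
have r0 : 0 < r by rewrite lt_min !divr_gt0// mulr_gt0.
have rD : r <= range_dist z0 / 2 by rewrite ge_min lexx.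
have rE : r <= eps * range_dist z0 / 8 by rewrite ge_min lexx orbT.
have inball : nbhs z0 (mball z0 r) by apply/nbhs_mballP; exists r.
apply: filterS2 out inball => z nz zr; rewrite /mball/= in zr.
have D := range_dist_gt0 nz.
have L := range_dist_lipschitz z0 z.
apply: unit_mdist_le => [|t]; first exact: ltW.
have [_ /(_ nz t)->] := HF z; have [_ /(_ nz0 t)->] := HF z0.
have zr' : mdist z z0 <= r by rewrite metric_sym ltW.
have H1 := hausdorff_ext_close t nz0 nz (ltW zr).
have H2 := hausdorff_ext_close t nz nz0 zr'.
have B1 : r / range_dist z <= eps / 4.
  rewrite ler_pdivrMr//.
  have : eps / 4 * (range_dist z0 / 2) <= eps / 4 * range_dist z.
    by rewrite ler_pM2l ?divr_gt0//; lra.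
  by lra.
have B2 : r / range_dist z0 <= eps / 4.
  rewrite ler_pdivrMr//.
  by have := mulr_gt0 eps0 D0; lra.
by rewrite ler_norml; apply/andP; split; lra.
Qed.

End UnitFunExtension.

Lemma unit_fun_ANR (R : realType) (T : Type) : ANR (unit_fun R T).
Proof.
move=> Z e emb; have [F cF Fe] := unit_fun_extension emb.
exists setT, (fun z => e (F z)); split => //.
- exact: openT.
- have [ce _ _ _] := emb; apply: within_continuous => z.
  exact: (continuous_comp (cF z) (ce (F z))).
- by move=> _ [z _ <-]; exists (F z).
- by move=> _ [y _ <-]; rewrite Fe.
Qed.

(** * Segments in the space of functions into the unit interval *)

Section Segments.
Context {R : realType} {T : Type}.
Local Notation Y := (unit_fun R T).

(** Clamping makes [segment] a total function of the parameter. *)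
Definition clamp (s : R) : R := Num.max 0 (Num.min s 1).

Lemma clamp_bound s : 0 <= clamp s <= 1.
Proof. by rewrite /clamp le_max lexx/= ge_max ler01 ge_min lexx orbT. Qed.

Lemma clamp_id s : 0 <= s <= 1 -> clamp s = s.
Proof. by move=> /andP[s0 s1]; rewrite /clamp min_l// max_r. Qed.

Lemma segment_bound s (f g : Y) t :
  0 <= (1 - clamp s) * f t + clamp s * g t <= 1.
Proof.
have /andP[s0 s1] := clamp_bound s.
have f0 := unit_ge0 f t; have f1 := unit_le1 f t.
have g0 := unit_ge0 g t; have g1 := unit_le1 g t.
by apply/andP; split; nra.
Qed.

Definition segment s (f g : Y) : Y := UnitFun (segment_bound s f g).

Lemma segment0 f g : segment 0 f g = f.
Proof.
apply: unit_fun_eq => t /=; rewrite clamp_id ?lexx ?ler01//.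
by rewrite subr0 mul1r mul0r addr0.
Qed.

Lemma segment1 f g : segment 1 f g = g.
Proof.
apply: unit_fun_eq => t /=; rewrite clamp_id ?lexx ?ler01//.
by rewrite subrr mul0r mul1r add0r.
Qed.

Lemma mball_segment (c f g : Y) r s :
  mball c r f -> mball c r g -> mball c r (segment s f g).
Proof.
rewrite /mball/= => cf cg.
apply: (@le_lt_trans _ _ (Num.max (mdist c f) (mdist c g))); last by rewrite gt_max cf.
have /andP[s0 s1] := clamp_bound s.
apply: unit_mdist_le => [|t]; first by rewrite le_max mdist_ge0.
have := unit_mdist_ge c f t; have := unit_mdist_ge c g t.
set m := Num.max _ _; have mf : mdist c f <= m by rewrite le_max lexx.
have mg : mdist c g <= m by rewrite le_max lexx orbT.
move=> /le_trans/(_ mg) + /le_trans/(_ mf); rewrite /= !ler_norml.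
by move=> /andP[a1 a2] /andP[b1 b2]; apply/andP; split; nra.
Qed.

Lemma segment_dist s s' (f f' g g' : Y) : 0 <= s <= 1 -> 0 <= s' <= 1 ->
  mdist (segment s f g) (segment s' f' g') <= `|s - s'| + mdist f f' + mdist g g'.
Proof.
move=> sb sb'; apply: unit_mdist_le => [|t].
  by rewrite !addr_ge0// mdist_ge0.
rewrite /= !clamp_id//; move: sb sb' => /andP[s0 s1] /andP[s0' s1'].
have := unit_mdist_ge f f' t; have := unit_mdist_ge g g' t.
move: (mdist f f') (mdist g g') => F G hg hf.
have -> : (1 - s) * f t + s * g t - ((1 - s') * f' t + s' * g' t) =
  (s - s') * (g' t - f' t) + (1 - s) * (f t - f' t) + s * (g t - g' t) by ring.
apply: le_trans (ler_normD _ _) _; apply: lerD; last first.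
  by rewrite normrM (ger0_norm s0); apply: le_trans hg; rewrite ler_piMl.
apply: le_trans (ler_normD _ _) _; apply: lerD; last first.
  rewrite normrM ger0_norm; last by lra.
  by apply: le_trans hf; rewrite ler_piMl//; lra.
rewrite normrM ler_piMr// ler_norml.
have := unit_ge0 f' t; have := unit_le1 f' t; have := unit_ge0 g' t.
by have := unit_le1 g' t; move=> *; apply/andP; split; lra.
Qed.

(** A collar of the boundary of the cube is filled by the segments from [f] to
    [h], and the rest by a filling of [h]. *)
Lemma fillable_segment d (f h : 'rV[R]_d -> Y) (U : set Y) :
  {within cube_bd d, continuous f} -> {within cube_bd d, continuous h} ->
  (forall x s, cube_bd d x -> U (segment s (f x) (h x))) ->
  fillable U h -> fillable U f.
Proof.
move=> cf ch seg [g [cg gU gh]].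
pose A : set 'rV[R]_d := [set x | 1 / 2 <= `|x|].
pose B : set 'rV[R]_d := [set x | `|x| <= 1 / 2].
pose outer (x : 'rV[R]_d) :=
  segment (2 - 2 * `|x|) (f (to_cube_bd x)) (h (to_cube_bd x)).
pose G x := if `|x| <= 1 / 2 then g (2 *: x) else outer x.
have A0 x : A x -> x != 0 by rewrite /A/= -normr_gt0; lra.
have GA x : (cube d `&` A) x -> outer x = G x.
  move=> [x1 xA]; rewrite /G; case: ifPn => // xB.
  have xE : `|x| = 1 / 2 by apply/eqP; rewrite eq_le xB.
  have -> : 2 *: x = to_cube_bd x by rewrite /to_cube_bd xE; congr (_ *: _); lra.
  rewrite gh; last exact/to_cube_bd_in/A0.
  by rewrite /outer xE (_ : 2 - 2 * (1 / 2) = 1) ?segment1//; lra.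
exists G; split.
- apply: (@within_paste2 _ _ _ B A).
  + apply: (@closed_comp _ _ (fun x : 'rV[R]_d => `|x| : R) [set r | r <= 1 / 2]).
      by move=> x _; exact: norm_continuous.
    exact: closed_le.
  + apply: (@closed_comp _ _ (fun x : 'rV[R]_d => `|x| : R) [set r | 1 / 2 <= r]).
      by move=> x _; exact: norm_continuous.
    exact: closed_ge.
  + by move=> x _; rewrite /A/B/=; case: (leP `|x| (1 / 2)) => [|/ltW]; [left|right].
  + apply: (@within_eq _ _ _ (fun x : 'rV[R]_d => g (2 *: x))) => [x [_ xB]|].
      by rewrite /G; move: xB; rewrite /B/= => ->.
    apply: (within_comp (B := cube d) (f := fun x : 'rV[R]_d => 2 *: x)) => //.
      by move=> x [_]; rewrite /B/cube/= normrZ gtr0_norm//; lra.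
    by apply: within_continuous => x; exact: (@cvgZl_tmp _ _ _ (nbhs x) _ 2 id x cvg_id).
  + apply: (within_eq GA); apply/within_oscP => x xA e e0.
    have sub y : (cube d `&` A) y -> cube_bd d (to_cube_bd y).
      by move=> [_ /A0/to_cube_bd_in].
    have cr : {within cube d `&` A, continuous (@to_cube_bd R d)}.
      by apply: within_at => y [_ /A0]; exact: to_cube_bd_continuous.
    have e8 : 0 < e / 8 by rewrite divr_gt0.
    have /within_oscP/(_ x xA _ e8) := within_comp sub cr cf.
    have /within_oscP/(_ x xA _ e8) := within_comp sub cr ch.
    have : \forall y \near x, `|(`|x| : R) - (`|y| : R)| <= e / 8.
      have /cvgrPdist_le := @norm_continuous _ _ x; exact.
    apply: filterS3 => y n1 n2 n3 yA.
    have sb z : (cube d `&` A) z -> 0 <= 2 - 2 * `|z| <= 1.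
      by rewrite /cube/A/= => -[z1 z2]; apply/andP; split; lra.
    apply: le_trans (segment_dist _ _ _ _ (sb x xA) (sb y yA)) _.
        move: n1 (n2 yA) (n3 yA); move: (`|x|) (`|y|) => a b n1 h1 h2.
    have -> : 2 - 2 * a - (2 - 2 * b) = 2 * (b - a) by ring.
    by rewrite normrM (gtr0_norm (ltr0n R 2)) distrC; lra.
- move=> x xc; have [xB|xB] := leP `|x| (1 / 2).
    rewrite /G xB; apply: gU; rewrite /cube/= normrZ gtr0_norm//; lra.
  have xA : A x by exact: ltW.
  by rewrite -GA//; apply: seg; exact/to_cube_bd_in/A0.
- move=> x x1; have xA : (cube d `&` A) x.
    by split; [exact: cube_bd_sub|rewrite /A/= x1; lra].
  rewrite -GA// /outer x1 mulr1 subrr segment0.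
  by rewrite /to_cube_bd x1 invr1 scale1r.
Qed.

End Segments.

(** * Local connectedness implies approximate local connectedness *)

Section LCtoALC.
Context {R : realType} (M : metricType R).
Hypothesis M_complete : complete_metric M.
Local Notation Y := (unit_fun R M).

Lemma truncated_dist_bound (x y : M) : 0 <= Num.min (mdist x y) 1 <= 1.
Proof. by rewrite le_min mdist_ge0 ler01 ge_min lexx orbT. Qed.

(** The Kuratowski embedding for the truncated distance. *)
Definition dist_fun (x : M) : Y := UnitFun (truncated_dist_bound x).

Lemma dist_fun_le x y : mdist (dist_fun x) (dist_fun y) <= mdist x y.
Proof.
apply: unit_mdist_le => [|t] /=; first exact: mdist_ge0.
have := metric_triangle x y t; have := metric_triangle y x t.
rewrite (metric_sym y x) => h1 h2; have := mdist_ge0 x y.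
rewrite ler_norml; case: (leP (mdist x t) 1) => h3; case: (leP (mdist y t) 1) => h4 h5;
  by apply/andP; split; lra.
Qed.

Lemma dist_fun_lt x y r : r <= 1 -> mdist (dist_fun x) (dist_fun y) < r ->
  mdist x y < r.
Proof.
move=> r1 H; have := le_lt_trans (unit_mdist_ge _ _ y) H.
rewrite /= mdistxx (min_l ler01) subr0 ger0_norm; last first.
  by have /andP[] := truncated_dist_bound x y.
by rewrite gt_min (ltNge 1) r1 orbF.
Qed.

Lemma dist_fun_continuous : continuous dist_fun.
Proof.
move=> x; apply/(@metricType_numDomainType.cvgrPdist_le _ _ _ (nbhs x)) => e e0.
apply/nbhs_mballP; exists e => // y xy.
by apply: le_trans (dist_fun_le x y) _; exact: ltW.
Qed.

Lemma dist_fun_inj : injective dist_fun.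
Proof.
move=> x y xy; apply/mdist_positivity/eqP; rewrite eq_le mdist_ge0 andbT.
apply/ler_addgt0Pl => e e0; rewrite addr0.
have : mdist x y < Num.min e 1.
  by apply: dist_fun_lt; rewrite ?ge_min ?lexx ?orbT// xy mdistxx lt_min e0 ltr01.
by rewrite lt_min => /andP[/ltW].
Qed.

(** Small distances are preserved, so the range inherits completeness. *)
Lemma dist_fun_closed : closed (range dist_fun).
Proof.
move=> f fcl.
have /choice[u Hu] : forall j : nat, exists x, mdist f (dist_fun x) < 1 / 2 ^+ j.+2.
  move=> j; have /fcl[_ [[x _ <-] fx]] : nbhs f (mball f (1 / 2 ^+ j.+2)).
    by apply/nbhs_mballP; exists (1 / 2 ^+ j.+2) => //; exact: half_pow_gt0.
  by exists x.
have pow1 (j : nat) : 1 / 2 ^+ j <= 1 :> R.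
  by rewrite ler_pdivrMr ?exprn_gt0// mul1r exprn_ege1// ler1n.
have uu j : mdist (u j) (u j.+1) <= 1 / 2 ^+ j.
  apply/ltW/dist_fun_lt => //.
  have := Hu j; have := Hu j.+1; rewrite !half_powS.
  have := metric_triangle (dist_fun (u j)) f (dist_fun (u j.+1)).
  rewrite (metric_sym (dist_fun (u j)) f).
  by have := @half_pow_gt0 R 1 j ltr01; lra.
have [l Hl] := complete_geometric_limit M_complete uu.
exists l => //; apply/esym/mdist_positivity/eqP; rewrite eq_le mdist_ge0 andbT.
apply/ler_addgt0Pl => e e0; rewrite addr0.
have [j Hj] := exists_half_pow_lt 3 e0.
have Ej : 3 / 2 ^+ j = 3 * (1 / 2 ^+ j) :> R by rewrite mul1r.
have := Hl j; have := Hu j; rewrite !half_powS.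
have := metric_triangle f (dist_fun (u j)) (dist_fun l).
have := dist_fun_le (u j) l.
by have := @half_pow_gt0 R 1 j ltr01; lra.
Qed.

Lemma dist_fun_open (U : set M) : open U -> open_in (range dist_fun) (dist_fun @` U).
Proof.
move=> oU; pose J := [set p : M * R | p.2 <= 1 /\ mball p.1 p.2 `<=` U].
exists (\bigcup_(p in J) mball (dist_fun p.1) p.2).
  by apply: bigcup_open => p _; exact: open_mball.
apply/seteqP; split => [f [[[x r] [/= r1 sub] xy] [y _ yE]]|_ [x Ux <-]].
  by rewrite -yE in xy *; exists y => //; apply: sub; exact: dist_fun_lt r1 xy.
split; last by exists x.
have /nbhs_mballP[r r0 sub] : nbhs x U by apply: open_nbhs_nbhs.
exists (x, Num.min r 1); first split => /=.
- by rewrite ge_min lexx orbT.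
- by move=> y; rewrite /mball/= lt_min => /andP[xy _]; exact: sub.
by rewrite /mball/= mdistxx lt_min r0 ltr01.
Qed.

Lemma dist_fun_embedding : closed_embedding dist_fun.
Proof.
split; [exact: dist_fun_continuous|exact: dist_fun_inj|exact: dist_fun_closed|].
exact: dist_fun_open.
Qed.

(** A sphere close to [M] is joined by segments to a map of the skeleton of a
    fine grid into [M]; the latter contracts in [M]. *)
Lemma LC_ALC n : LC R n M -> ALC n M.
Proof.
move=> /LC_cubeP lc; pose e := dist_fun.
exists Y, e; split; [exact: unit_fun_ANR|exact: dist_fun_embedding|].
split; first exact: dist_fun_closed.
move=> _ U [x _ <-] [W oW WU] Ux.
have UE y : U (e y) <-> W (e y).
  by rewrite -WU; split => [[]//|Wy]; split => //; exists y.
have oU' : open (e @^-1` W) by apply: open_comp => // y _; exact: dist_fun_continuous.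
have U'x : (e @^-1` W) x by apply/UE.
have [V0 V0x HV0] := lc x _ oU' U'x.
have /nbhs_mballP[rho2 rho20 sub2] : nbhs x (V0 `&` (e @^-1` W)).
  by apply: filterI => //; apply: open_nbhs_nbhs.
pose rho := rho2 / 2; have rho0 : 0 < rho by rewrite divr_gt0.
have sub y : mdist x y < 2 * rho -> V0 y /\ U (e y).
  by move=> xy; have [|V0y /UE] := sub2 y; [move: xy; rewrite /rho/mball/=; lra|].
have [OV oOV OVE] := dist_fun_open (@open_mball _ _ x rho).
exists (e @` mball x rho).
  split; first by move=> _ [y _ <-]; exists y.
  exists (e @` mball x rho); first by exists OV.
  by split => //; exists x => //; rewrite /mball/= mdistxx.
move=> Ue [oUe UeE].
have UUe y : U (e y) -> Ue (e y) by rewrite -UeE => -[].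
(* the scale on which segments starting near [mball x rho] stay in [Ue] *)
have [|y|a ga Ha] := @gauge_inf R M (fun y r => r <= rho /\
    (mdist x y < rho -> mball (e y) r `<=` Ue)).
- move=> y r s sr [rr H]; split => [|xy z]; first exact: le_trans sr rr.
  by rewrite /mball/= => /lt_le_trans/(_ sr); exact: H.
- have [far|near] := leP (2 * rho) (mdist x y).
    exists rho => // z yz; split => // xz; exfalso.
    by have := metric_triangle x z y; rewrite (metric_sym z y); lra.
  have [_ /UUe Uy] := sub y near.
  have /nbhs_mballP[s s0 sUe] : nbhs (e y) Ue by apply: open_nbhs_nbhs.
  exists (Num.min (s / 2) rho) => [|z]; first by rewrite lt_min divr_gt0.
  rewrite lt_min => /andP[yz _]; split => [|_ f]; first by rewrite ge_min lexx orbT.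
  rewrite /mball/= lt_min => /andP[zf _]; apply: sUe; rewrite /mball/=.
  by have := metric_triangle (e y) (e z) f; have := dist_fun_le y z; lra.
have lcn : LC_cube n M.
  move=> y V oV Vy; have [V' V'y HV'] := lc y V oV Vy; exists V' => // d /andP[d0 dn].
  by apply: HV'; rewrite d0 ltnW.
have [b [gb ba Hb]] := skeleton_extension lcn ga.
have [r r0 Hr] := tracking_radius (closed_embedding_inv dist_fun_embedding) gb.
pose r' y := Num.min (r y) (a y).
have r'r y : r' y <= r y by rewrite ge_min lexx.
have r'a y : r' y <= a y by rewrite ge_min lexx orbT.
have r'0 y : 0 < r' y by rewrite lt_min r0 ga.1.
pose Om m := mball (e m) (r' m).
exists (OV `&` \bigcup_(m in mball x rho) Om m).
  split; first by apply: openI => //; apply: bigcup_open => m _; exact: open_mball.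
  rewrite setIAC OVE; apply/seteqP; split => [y []//|_ [m xm <-]].
  split; first by exists m.
  by exists m => //; rewrite /Om/mball/= mdistxx.
move=> k kn f [cf fV]; apply: fillable_null_homotopic.
pose F p := f (to_sphere p).
have cF : {within cube_bd k.+1, continuous F} by exact: within_to_sphere.
have FV p : cube_bd k.+1 p -> exists2 m, mball x rho m & Om m (F p).
  move=> pb; suff [] : (OV `&` \bigcup_(m in mball x rho) Om m) (F p) by [].
  by apply: fV; exists (to_sphere p) => //; exact/to_sphere_in/cube_bd_neq0.
have [|N HN] := lebesgue_mesh (@compact_cube_bd R k.+1) cF _ FV.
  by move=> m; exact: open_mball.
have /choice[m Hm] : forall p, exists m, cube_bd k.+1 p -> mball x rho m /\
    forall q, cube_bd k.+1 q -> `|p - q| <= 2 / N.+1%:R -> Om m (F q).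
  move=> p; have [pb|] := pselect (cube_bd k.+1 p); last by exists x.
  by have [m xm H] := HN p pb; exists m.
have mm p q : cube_bd k.+1 p -> cube_bd k.+1 q -> `|p - q| <= 2 / N.+1%:R ->
    mdist (m p) (m q) < b (m p).
  move=> pb qb pq; have [_ Hp] := Hm p pb; have [_ Hq] := Hm q qb.
  have {}Hp := Hp q qb pq.
  have {}Hq : Om (m q) (F q) by apply: Hq => //; rewrite subrr normr0 divr_ge0.
  rewrite /Om/mball/= in Hp Hq.
  have [|lt _] := Hr (m p) (m q).
    have := metric_triangle (e (m p)) (F q) (e (m q)); have := r'r (m p).
    by rewrite (metric_sym (F q) (e (m q))); have := r'r (m q); lra.
  by have := gb.1 (m p); lra.
pose X : set 'rV[R]_k.+1 := cube_bd k.+1.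
have sub0 (p : 'rV[R]_k.+1) : skel N set0 X 0 p -> X p.
  by move=> [//|[c [_ cX cp]]]; exact: cX.
(* the map is prescribed at the vertices alone, and the boundary of the cube is
   the complex to be mapped *)
have [||c cX|h [hm ch hs]] := Hb k.+1 N set0 X m (@closed0 _).
- by move=> c p.
- by apply: skel0_continuous; [exact: closed0|apply/within_oscP].
- move=> p q [cp /sub0 pb] [cq /sub0 qb]; apply: mm => //; exact: ccell_mesh cp cq.
(* a vertex of a cell through [p] controls both ends of the segment at [p] *)
have near p : X p -> exists w, [/\ mball x rho w, mdist w (h p) < a w & Om w (F p)].
  move=> pb; have [c oc] := ocell_exists N (cube_bd_sub pb).
  have cX := ocell_cube_bd oc pb; have cn := ocell_cube_bd_dim oc pb.
  have cp := ocell_sub oc.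
  have [v [q [v0 vq vc]]] := @vertex_exists R _ _ c.
  have sq : skel N set0 X 0 q.
    by right; exists v; split => //; [rewrite v0|exact: subset_trans cX].
  exists (m q); have [xm Hq] := Hm q (sub0 _ sq); split => //.
    rewrite -(hm q sq); apply: (hs c cX); first by split; [exact: vc|exact: skelS sq].
    split => //; right; exists c; split => //.
    by rewrite -ltnS; apply: leq_trans cn _.
  by apply: Hq => //; exact: (ccell_mesh (vc _ vq) cp).
have bd_skel : X `<=` skel N set0 X n.
  move=> p pb; have [c oc] := ocell_exists N (cube_bd_sub pb).
  right; exists c; split; last exact: ocell_sub.
    by rewrite -ltnS; apply: leq_trans (ocell_cube_bd_dim oc pb) _.
  exact: ocell_cube_bd oc pb.
have chX : {within X, continuous h} by exact: continuous_subspaceW ch.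
apply: (@fillable_segment _ _ _ F (fun p => e (h p))) => //.
- apply: (@within_comp _ _ _ X setT h e) => //.
  by apply: within_continuous; exact: dist_fun_continuous.
- move=> p s pb; have [w [xw hw Fw]] := near p pb.
  have [_ /(_ xw)] := Ha w; apply; apply: mball_segment.
    by apply: lt_le_trans Fw _.
  by apply: le_lt_trans hw; exact: dist_fun_le.
have [||g [cg gU gh]] := HV0 k.+1 _ h chX.
- by rewrite ltnS.
- move=> p pb; have [w [xw hw _]] := near p pb; apply: (proj1 (sub _ _)).
  have [aw _] := Ha w; move: xw; rewrite /mball/=.
  by have := metric_triangle x w (h p); lra.
exists (fun p => e (g p)); split.
- apply: (@within_comp _ _ _ _ setT g e) => //.
  by apply: within_continuous; exact: dist_fun_continuous.
- by move=> p pc; apply/UUe/UE/gU.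
- by move=> p pb; rewrite gh.
Qed.

End LCtoALC.

Theorem theorem2p7 (R : realType) (n : nat) (M : metricType R)
    (Mcomplete : complete_metric M) :
  [<-> LC R n M; ALC n M; WLC n M].
Proof.
tfae; [exact: LC_ALC|exact: ALC_WLC|exact: WLC_LC].
Qed.
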